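(* Let $n,m\in\mathbb{N}_0$ with $n\ge m$, let $\nu\in\mathbb{C}\setminus\{2m,2m+2,2m+4,\dots\}$, let $r,r'\in(0,\infty)$ with $r\ne r'$, and let $\theta'\in(0,\pi)$. Then \[ \int_0^\pi (\chi^2-1)^{(\nu+1)/4}\,Q^{-(\nu+1)/2}_{m-1/2}(\chi)\,\mathrm{P}^m_n(\cos\theta)\,(\sin\theta)^{(\nu+2)/2}\,d\theta =\frac{i\sqrt{\pi}}{2^{(\nu+1)/2}(\sin\theta')^{\nu/2}}\left(\frac{r_>^2-r_<^2}{rr'}\right)^{(\nu+2)/2} Q_n^{-(\nu+2)/2}\!\left(\frac{r^2+r'^2}{2rr'}\right)\mathrm{P}^m_n(\cos\theta'), \] where $\chi=\dfrac{r^2+r'^2-2rr'\cos\theta\cos\theta'}{2rr'\sin\theta\sin\theta'}$ and $r_<=\min\{r,r'\}$, $r_>=\max\{r,r'\}$.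
   Context: For $z\in\mathbb{C}\setminus(-\infty,1]$, $Q^\mu_\nu(z)=e^{\mu\pi i}\frac{\sqrt{\pi}\,\Gamma(\nu+\mu+1)(z^2-1)^{\mu/2}}{2^{\nu+1}z^{\nu+\mu+1}}\,\mathbf{F}\!\left(\frac{\nu+\mu}{2}+1,\frac{\nu+\mu+1}{2};\nu+\frac32;\frac{1}{z^2}\right)$ is the associated Legendre function of the second kind, with $\mathbf{F}(a,b;c;x)={}_2F_1(a,b;c;x)/\Gamma(c)$ and principal branches. $\mathrm{P}^\mu_\nu$ is the Ferrers function of the first kind: for $x\in(-1,1)$, $\mathrm{P}^\mu_\nu(x)=\left(\frac{1+x}{1-x}\right)^{\mu/2}\mathbf{F}\!\left(\nu+1,-\nu;1-\mu;\frac{1-x}{2}\right)$; for integers $0\le m\le n$ this equals $(-1)^m(1-x^2)^{m/2}\frac{d^m}{dx^m}P_n(x)$ with $P_n$ the Legendre polynomial. All non-integer powers of positive reals are the positive ones. *)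

(* Defs.v *)
From Stdlib Require Import Reals Factorial.
From Coquelicot Require Import Coquelicot.
Open Scope R_scope.

Definition Cexp (z : C) : C :=
  (exp (Re z) * cos (Im z), exp (Re z) * sin (Im z)).

(* x^w for a positive real base x and complex exponent w (principal value,
   i.e. exp (w ln x)); only ever applied to positive reals x. *)
Definition Crpow (x : R) (w : C) : C := Cexp (w * RtoC (ln x))%C.

Fixpoint Cpoch (a : C) (k : nat) : C :=
  match k with
  | O => 1%C
  | S k' => (Cpoch a k' * (a + RtoC (INR k')))%C
  end.

(* Limit of a complex sequence (defined via iota; meaningful when the limit exists). *)
Definition Clim_seq (u : nat -> C) : C :=
  @iota C_CompleteNormedModule (fun l : C => filterlim u eventually (locally l)).

Definition Cseries (a : nat -> C) : C :=
  @iota C_CompleteNormedModule (fun l : C => is_series (V := C_NormedModule) a l).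

(* Reciprocal Gamma function 1/Gamma(z) (entire), by Gauss' product formula:
   1/Gamma(z) = lim_N z (z+1) ... (z+N) / (N! N^z). *)
Definition rgamma (z : C) : C :=
  Clim_seq (fun N => (Cpoch z (S N) / (RtoC (INR (fact N)) * Crpow (INR N) z))%C).

(* Euler Gamma function (at non-poles). *)
Definition CGamma (z : C) : C := Cinv (rgamma z).

(* Regularized hypergeometric function F(a,b;c;x) = 2F1(a,b;c;x)/Gamma(c)
   = sum_k (a)_k (b)_k / (Gamma(c+k) k!) x^k  (|x| < 1). *)
Definition hyp2F1reg (a b c x : C) : C :=
  Cseries (fun k => (Cpoch a k * Cpoch b k * rgamma (c + RtoC (INR k))
                     / RtoC (INR (fact k)) * x ^ k)%C).

(* Associated Legendre function of the second kind Q^mu_nu(x), for real x > 1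
   (the only arguments used), with the paper's hypergeometric definition. *)
Definition LegendreQ (mu nu : C) (x : R) : C :=
  (Cexp (mu * RtoC PI * Ci) * RtoC (sqrt PI) * CGamma (nu + mu + 1)
   * Crpow (x ^ 2 - 1) (mu / 2)
   / (Crpow 2 (nu + 1) * Crpow x (nu + mu + 1))
   * hyp2F1reg ((nu + mu) / 2 + 1) ((nu + mu + 1) / 2) (nu + RtoC (3 / 2))
               (RtoC (/ (x ^ 2))))%C.

(* Ferrers function of the first kind P^mu_nu(x), for x in (-1,1). *)
Definition FerrersP (mu nu : C) (x : R) : C :=
  (Crpow ((1 + x) / (1 - x)) (mu / 2)
   * hyp2F1reg (nu + 1) (- nu) (1 - mu) (RtoC ((1 - x) / 2)))%C.

(* Main.v *)
(* Write [s = -nu/2], [a = m + s], [d = n - m], [t = cos th], [t' = cos th'] and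
   [x = (r^2 + r'^2)/(2 r r') > 1], so that [chi = (x - t t')/(sin th sin th')].
   In the integrand the powers of [chi^2 - 1] cancel.  Expanding the
   hypergeometric series of Q in powers of [1/chi], and each of these by the
   binomial series in [t t'/x], all dependence on [nu] goes into factors
   [(a)_N x^(-a-N)]: up to constants the integrand is
   [sum_N (a)_N x^-N G_N(t,t') (1-t^2)^m Y(t) sin th], where [G_N] is a
   polynomial kernel with [|G_N| <= 1/N!] and [Y] is the polynomial
   2F1(-d, d+2m+1; m+1; (1-t)/2), proportional to [(1-t^2)^(-m/2) P^m_n(t)].
   Convergence is uniform, so one may integrate termwise.  The Gegenbauer operator
   [L = (1-t^2) D^2 - 2(m+1) t D] acts identically on both variables of [G_N]
   and is self-adjoint for the weight [(1-t^2)^m]; hence the integral of [G_N]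
   against [Y] is a polynomial eigenfunction of [L], i.e. [c_N Y(t')].  Setting
   [t' = 1] gives [c_N] as a moment of [Y], evaluated by integration by parts;
   it vanishes unless [N = d + 2k], and the remaining series is that of Q on the
   right-hand side. *)

Require Import Defs.
From Stdlib Require Import Reals Lra Lia Factorial.
From Coquelicot Require Import Coquelicot.
Open Scope R_scope.

(** The complex parameter [nu] enters the expansion only through the scalars [Cpoch a N] and a few
    prefactors. Kernel, weight and [gpoly] are real, so the spectral argument takes place entirely
    over real polynomials, and complex analysis is confined to scalar series. Limits and sums are
    chosen by [iota], so a value is known only once convergence is proved. This shapes the treatment
    of 1/Gamma: Gauss' product must be shown to converge before its functional equation can be used.
    The series on the left has Gamma at integers in its denominators, the one on the right at
    half-integers; the latter need 1/Gamma(1/2), which comes from the Wallis integrals. The values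
    excluded for [nu] are exactly those with [a + j = 0] for some natural [j]. Hence [a] is not a
    pole of Gamma and [(a)_d] may be divided by when the two sides are compared. *)

Ltac rewrite_Derive H :=
  match type of H with is_derive ?f ?x ?l =>
    rewrite (is_derive_unique (fun u : R => f u) x l H) end.

Ltac eqR := match goal with |- @eq _ ?a ?b => change (@eq R a b) end.

(** * Polynomial solutions of the Gegenbauer equation *)

(** Degree below [n], encoded as vanishing of the [n]-th derivative. Differentiation lowers the
    index, so facts about solutions of differential equations go by induction without touching
    coefficients. *)
Fixpoint polyfun (n : nat) (f : R -> R) : Prop :=
  match n with
  | O => forall t, f t = 0
  | S n' => exists g : R -> R, (forall t : R, is_derive f t (g t)) /\ polyfun n' g
  end.

Definition polynomial (f : R -> R) : Prop := exists n, polyfun n f.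

Lemma polyfun_ext n f g : (forall t, f t = g t) -> polyfun n f -> polyfun n g.
Proof.
  destruct n as [|n]; simpl; intros Hfg Hf.
  - intros t; rewrite <- Hfg; auto.
  - destruct Hf as [h [Hh Hp]]; exists h; split; [|exact Hp].
    intros t; apply (is_derive_ext f); auto.
Qed.

Lemma polyfun_S n f : polyfun n f -> polyfun (S n) f.
Proof.
  revert f; induction n as [|n IH]; intros f Hf.
  - exists (fun _ => 0); split; [|intros t; reflexivity].
    intros t; apply (is_derive_ext (fun _ => 0)); [intros; symmetry; apply Hf|].
    apply @is_derive_const.
  - destruct Hf as [g [Hg Hp]]; exists g; split; auto.
Qed.

Lemma polyfun_add k n f : polyfun n f -> polyfun (k + n) f.
Proof. induction k; intros H; [exact H|]. apply polyfun_S; auto. Qed.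

Lemma polyfun_derive n f : polyfun n f ->
  exists g : R -> R, (forall t : R, is_derive f t (g t)) /\ polyfun (pred n) g.
Proof.
  destruct n as [|n]; intros Hf; [|exact Hf].
  apply polyfun_S in Hf; exact Hf.
Qed.

Lemma polyfun_plus n f g :
  polyfun n f -> polyfun n g -> polyfun n (fun t => f t + g t).
Proof.
  revert f g; induction n as [|n IH]; intros f g Hf Hg.
  - intros t; rewrite Hf, Hg; ring.
  - destruct Hf as [f' [Hf1 Hf2]]; destruct Hg as [g' [Hg1 Hg2]].
    exists (fun t => f' t + g' t); split; [|auto].
    intros t; apply @is_derive_plus; auto.
Qed.

(** Each of the two Leibniz terms lowers [n1 + n2] by one, hence the induction on a bound for the
    sum. *)
Lemma polyfun_mult k n1 n2 f g : (n1 + n2 <= k)%nat ->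
  polyfun n1 f -> polyfun n2 g -> polyfun k (fun t => f t * g t).
Proof.
  revert n1 n2 f g; induction k as [|k IH]; intros n1 n2 f g Hk Hf Hg.
  - assert (n1 = O) by lia; subst; intros t; rewrite Hf; ring.
  - destruct n1 as [|n1].
    { replace (S k) with (S k + 0)%nat by lia; apply polyfun_add.
      intros t; rewrite Hf; ring. }
    destruct n2 as [|n2].
    { replace (S k) with (S k + 0)%nat by lia; apply polyfun_add.
      intros t; rewrite Hg; ring. }
    destruct (Hf) as [f' [Hf1 Hf2]]; destruct (Hg) as [g' [Hg1 Hg2]].
    exists (fun t => f' t * g t + f t * g' t); split.
    + intros t; auto_derive.
      * split; [exists (f' t); auto|]; split; [exists (g' t); auto|auto].
      * rewrite_Derive (Hf1 t); rewrite_Derive (Hg1 t).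
        ring.
    + apply polyfun_plus; [apply (IH n1 (S n2)) | apply (IH (S n1) n2)]; auto; lia.
Qed.

Lemma polynomial_ext f g :
  (forall t, f t = g t) -> polynomial f -> polynomial g.
Proof. intros H [n Hn]; exists n; apply (polyfun_ext n f); auto. Qed.

Lemma polynomial_const c : polynomial (fun _ => c).
Proof.
  exists 1%nat; exists (fun _ => 0); split; [|intros t; reflexivity].
  intros t; apply @is_derive_const.
Qed.

Lemma polynomial_id : polynomial (fun t => t).
Proof.
  exists 2%nat; exists (fun _ => 1); split; [intros t; apply @is_derive_id|].
  exists (fun _ => 0); split; [|intros t; reflexivity].
  intros t; apply @is_derive_const.
Qed.

Lemma polynomial_plus f g :
  polynomial f -> polynomial g -> polynomial (fun t => f t + g t).
Proof.
  intros [a Ha] [b Hb]; exists (a + b)%nat; apply polyfun_plus.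
  - rewrite Nat.add_comm; apply polyfun_add; auto.
  - apply polyfun_add; auto.
Qed.

Lemma polynomial_mult f g :
  polynomial f -> polynomial g -> polynomial (fun t => f t * g t).
Proof. intros [a Ha] [b Hb]; exists (a + b)%nat; apply (polyfun_mult _ a b); auto. Qed.

Lemma polynomial_opp f : polynomial f -> polynomial (fun t => - f t).
Proof.
  intros H; apply (polynomial_ext (fun t => (-1) * f t)); [intros; ring|].
  apply polynomial_mult; [apply polynomial_const|exact H].
Qed.

Lemma polynomial_minus f g :
  polynomial f -> polynomial g -> polynomial (fun t => f t - g t).
Proof. intros; apply polynomial_plus; [|apply polynomial_opp]; auto. Qed.

Lemma polynomial_pow f k : polynomial f -> polynomial (fun t => f t ^ k).
Proof.
  intros H; induction k as [|k IH]; simpl; [apply polynomial_const|].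
  apply polynomial_mult; auto.
Qed.

Lemma polynomial_sum (f : nat -> R -> R) K : (forall k, polynomial (f k)) ->
  polynomial (fun t => sum_f_R0 (fun k => f k t) K).
Proof.
  intros H; induction K as [|K IH]; simpl; [apply H|].
  apply polynomial_plus; auto.
Qed.

Lemma polynomial_derive f f' : polynomial f ->
  (forall t : R, is_derive f t (f' t)) -> polynomial f'.
Proof.
  intros [n Hn] Hd; destruct (polyfun_derive n f Hn) as [g [Hg Hp]].
  exists (pred n); apply (polyfun_ext _ g); [|exact Hp].
  intros t; rewrite <- (is_derive_unique _ _ _ (Hg t)).
  apply is_derive_unique; auto.
Qed.

Lemma polynomial_ex_derive f : polynomial f ->
  exists f' : R -> R, forall t : R, is_derive f t (f' t).
Proof.
  intros [n Hn]; destruct (polyfun_derive n f Hn) as [g [Hg _]]; exists g; auto.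
Qed.

Lemma polynomial_continuous f t : polynomial f -> continuous f t.
Proof.
  intros Hf; destruct (polynomial_ex_derive f Hf) as [g Hg].
  apply (ex_derive_continuous (K := R_AbsRing) (V := R_NormedModule)).
  exists (g t); auto.
Qed.

Create HintDb poly.
#[local] Hint Resolve polynomial_const polynomial_id polynomial_plus
  polynomial_mult polynomial_opp polynomial_minus polynomial_pow
  polynomial_sum : poly.

Lemma polynomial_ex_RInt f a b : polynomial f -> ex_RInt f a b.
Proof.
  intros Hf; apply @ex_RInt_continuous; intros; apply polynomial_continuous, Hf.
Qed.

Lemma polynomial_RInt_derive f f' a b : polynomial f ->
  (forall t : R, is_derive f t (f' t)) -> RInt f' a b = f b - f a.
Proof.
  intros Hf Hd; apply is_RInt_unique.
  apply @is_RInt_derive; intros t _; [apply Hd|].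
  apply polynomial_continuous, (polynomial_derive f); auto.
Qed.

Lemma RInt_lincomb (f g : R -> R) a b u v : polynomial f -> polynomial g ->
  RInt (fun t => u * f t - v * g t) a b = u * RInt f a b - v * RInt g a b.
Proof.
  intros Hf Hg; apply is_RInt_unique.
  apply @is_RInt_minus; apply @is_RInt_scal, @RInt_correct, polynomial_ex_RInt;
    auto.
Qed.

Lemma is_derive_zero_const (f : R -> R) :
  (forall t : R, is_derive f t 0) -> forall s t, f s = f t.
Proof.
  intros H s t.
  destruct (Rtotal_order s t) as [L|[L|L]]; [|subst; reflexivity|symmetry];
    apply @eq_is_derive; auto; intros; apply H.
Qed.

Lemma gegenbauer_ode_derive (mu E : R) (H0 H1 H2 H3 : R -> R) :
  (forall t : R, is_derive H0 t (H1 t)) -> (forall t : R, is_derive H1 t (H2 t)) ->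
  (forall t : R, is_derive H2 t (H3 t)) ->
  (forall t, (1 - t ^ 2) * H2 t - 2 * (mu + 1) * t * H1 t + E * H0 t = 0) ->
  forall t, (1 - t ^ 2) * H3 t - 2 * (mu + 1 + 1) * t * H2 t
            + (E - 2 * (mu + 1)) * H1 t = 0.
Proof.
  intros D0 D1 D2 Ode t.
  assert (Z : is_derive
    (fun t => (1 - t ^ 2) * H2 t - 2 * (mu + 1) * t * H1 t + E * H0 t) t 0).
  { apply (is_derive_ext (fun _ => 0)); [intros; symmetry; apply Ode|].
    apply @is_derive_const. }
  apply is_derive_unique in Z; rewrite <- Z; symmetry; apply is_derive_unique.
  auto_derive.
  - repeat split; [exists (H3 t)|exists (H2 t)|exists (H1 t)]; auto.
  - rewrite_Derive (D0 t); rewrite_Derive (D1 t); rewrite_Derive (D2 t); ring.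
Qed.

(* The derivative of a solution solves the same equation with [mu] raised by
   one, and at [t = 1] the equation gives [H1 1] from [H0 1]; so a solution
   vanishing at 1 has all its derivatives vanishing there. *)
Lemma gegenbauer_ode_unique n (mu E : R) (H0 H1 H2 : R -> R) :
  polyfun n H0 -> 0 <= mu ->
  (forall t : R, is_derive H0 t (H1 t)) -> (forall t : R, is_derive H1 t (H2 t)) ->
  (forall t, (1 - t ^ 2) * H2 t - 2 * (mu + 1) * t * H1 t + E * H0 t = 0) ->
  H0 1 = 0 -> forall t, H0 t = 0.
Proof.
  revert mu E H0 H1 H2; induction n as [|n IH];
    intros mu E H0 H1 H2 Hp Hmu D0 D1 Ode H01; [exact Hp|].
  destruct Hp as [g [Hg Hp]].
  assert (Hp1 : polyfun n H1).
  { apply (polyfun_ext n g); [|exact Hp]; intros t.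
    rewrite <- (is_derive_unique _ _ _ (Hg t)); apply is_derive_unique, D0. }
  assert (P2 : polynomial H2) by (apply (polynomial_derive H1); [exists n|]; auto).
  destruct (polynomial_ex_derive H2 P2) as [H3 D2].
  assert (Z : forall t, H1 t = 0).
  { apply (IH (mu + 1) (E - 2 * (mu + 1)) H1 H2 H3); auto; [lra| |].
    - apply (gegenbauer_ode_derive mu E H0 H1 H2 H3); auto.
    - specialize (Ode 1); rewrite H01 in Ode.
      assert (2 * (mu + 1) * H1 1 = 0) by lra; nra. }
  intros t; rewrite <- H01; apply is_derive_zero_const.
  intros u; rewrite <- (Z u); apply D0.
Qed.

(* Coefficients of [2F1(-d, d+2m+1; m+1; y)] in powers of [y = (1-t)/2]. *)
Fixpoint gcoef (d m l : nat) : R :=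
  match l with
  | O => 1
  | S l' => gcoef d m l' * ((INR l' - INR d) * (INR l' + INR d + 2 * INR m + 1))
            / ((INR l' + 1) * (INR l' + INR m + 1))
  end.

Definition gpart (d m K : nat) (t : R) : R :=
  sum_f_R0 (fun l => gcoef d m l * ((1 - t) / 2) ^ l) K.

Definition gpoly (d m : nat) : R -> R := gpart d m d.

Lemma gpart_polynomial d m K : polynomial (gpart d m K).
Proof. unfold gpart, Rdiv; auto 10 with poly. Qed.

Lemma gpoly_polynomial d m : polynomial (gpoly d m).
Proof. apply gpart_polynomial. Qed.

#[local] Hint Resolve gpoly_polynomial : poly.

Lemma is_derive_half_pow c k (t : R) :
  is_derive (fun t => c * ((1 - t) / 2) ^ k) t
    (c * (INR k * (- / 2) * ((1 - t) / 2) ^ pred k)).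
Proof. auto_derive; auto; unfold Rdiv, Rminus; ring. Qed.

(** The hypergeometric recurrence cancels all terms but the last one, so a truncated series solves
    the equation up to a single monomial. That monomial carries the factor [K - d] and disappears at
    [K = d]. *)
Lemma gpart_ode d m K : exists S1 S2 : R -> R,
  (forall t : R, is_derive (gpart d m K) t (S1 t)) /\
  (forall t : R, is_derive S1 t (S2 t)) /\
  (forall t, (1 - t ^ 2) * S2 t - 2 * (INR m + 1) * t * S1 t
     + INR d * (INR d + 2 * INR m + 1) * gpart d m K t
   = - ((INR K - INR d) * (INR K + INR d + 2 * INR m + 1))
     * gcoef d m K * ((1 - t) / 2) ^ K).
Proof.
  induction K as [|K [S1 [S2 [D1 [D2 Ode]]]]].
  - exists (fun _ => 0), (fun _ => 0); split; [|split].
    + intros t; unfold gpart; simpl; auto_derive; auto; ring.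
    + intros t; apply @is_derive_const.
    + intros t; unfold gpart; simpl; ring.
  - set (c := gcoef d m (S K)).
    exists (fun t => S1 t + c * (INR (S K) * (- / 2) * ((1 - t) / 2) ^ K)),
      (fun t => S2 t + c * (INR (S K) * (- / 2)
                  * (INR K * (- / 2) * ((1 - t) / 2) ^ pred K))).
    split; [|split].
    + intros t; unfold gpart; simpl sum_f_R0; fold c.
      apply @is_derive_plus; [apply D1|].
      apply (is_derive_half_pow c (S K)).
    + intros t; apply @is_derive_plus; [apply D2|].
      apply (is_derive_ext (fun t => c * (INR (S K) * - / 2) * ((1 - t) / 2) ^ K));
        [intros; eqR; ring|].
      evar_last; [apply is_derive_half_pow|eqR; ring].
    + intros t; specialize (Ode t).
      replace (gpart d m (S K) t) with (gpart d m K t + c * ((1 - t) / 2) ^ S K)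
        by reflexivity.
      assert (Hc : (INR K + 1) * (INR K + INR m + 1) * c
        = gcoef d m K * ((INR K - INR d) * (INR K + INR d + 2 * INR m + 1))).
      { unfold c; simpl gcoef; pose proof (pos_INR K); pose proof (pos_INR m).
        field; lra. }
      rewrite S_INR.
      set (x := (1 - t) / 2) in *.
      (* The factor [INR K] matters: at [K = 0] the truncated [pred K] gives the wrong power, but
         both sides vanish. *)
      assert (Hx : INR K * x ^ pred K * x = INR K * x ^ K).
      { destruct K as [|K']; simpl; ring. }
      replace t with (1 - 2 * x) in * by (unfold x; field).
      set (g := gpart d m K (1 - 2 * x)) in *.
      set (s1 := S1 (1 - 2 * x)) in *; set (s2 := S2 (1 - 2 * x)) in *.
      replace ((1 - (1 - 2 * x) ^ 2) *
        (s2 + c * ((INR K + 1) * - / 2 * (INR K * - / 2 * x ^ pred K))) -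
        2 * (INR m + 1) * (1 - 2 * x) * (s1 + c * ((INR K + 1) * - / 2 * x ^ K)) +
        INR d * (INR d + 2 * INR m + 1) * (g + c * x ^ S K)) with
       (((1 - (1 - 2 * x) ^ 2) * s2 - 2 * (INR m + 1) * (1 - 2 * x) * s1 +
        INR d * (INR d + 2 * INR m + 1) * g)
        + (1 - x) * c * (INR K + 1) * (INR K * x ^ pred K * x)
        + (INR m + 1) * (1 - 2 * x) * (c * ((INR K + 1) * x ^ K))
        + INR d * (INR d + 2 * INR m + 1) * c * x ^ S K) by (simpl; field).
      rewrite Ode, Hx.
      apply Rminus_diag_uniq.
      transitivity (x ^ K * ((INR K + 1) * (INR K + INR m + 1) * c
        - gcoef d m K * ((INR K - INR d) * (INR K + INR d + 2 * INR m + 1)))).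
      { simpl pow; ring. }
      rewrite Hc; ring.
Qed.

Lemma gpoly_ode d m : exists Y1 Y2 : R -> R,
  (forall t : R, is_derive (gpoly d m) t (Y1 t)) /\
  (forall t : R, is_derive Y1 t (Y2 t)) /\
  (forall t, (1 - t ^ 2) * Y2 t - 2 * (INR m + 1) * t * Y1 t
     + INR d * (INR d + 2 * INR m + 1) * gpoly d m t = 0).
Proof.
  destruct (gpart_ode d m d) as [S1 [S2 [D1 [D2 Ode]]]].
  exists S1, S2; split; [|split]; auto.
  intros t; unfold gpoly; rewrite Ode; ring.
Qed.

Lemma gpoly_1 d m : gpoly d m 1 = 1.
Proof.
  (* Only the truncation index is generalised: every partial sum equals 1 at [t = 1]. *)
  unfold gpoly; generalize d at 2; intros K; unfold gpart.
  induction K as [|K IH]; simpl in *; [ring|].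
  rewrite IH; replace ((1 - 1) / 2) with 0 by field; ring.
Qed.

(** Uniqueness is applied to [H0 - H0 1 * gpoly d m], which vanishes at 1 because [gpoly] equals 1
    there. *)
Lemma gpoly_eigen_unique d m (H0 H1 H2 : R -> R) :
  polynomial H0 ->
  (forall t : R, is_derive H0 t (H1 t)) -> (forall t : R, is_derive H1 t (H2 t)) ->
  (forall t, (1 - t ^ 2) * H2 t - 2 * (INR m + 1) * t * H1 t
             + INR d * (INR d + 2 * INR m + 1) * H0 t = 0) ->
  forall t, H0 t = H0 1 * gpoly d m t.
Proof.
  intros P D0 D1 Ode t.
  destruct (gpoly_ode d m) as [Y1 [Y2 [E1 [E2 Yode]]]].
  assert (PD : polynomial (fun t => H0 t - H0 1 * gpoly d m t)) by auto with poly.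
  destruct PD as [n Hn].
  apply Rminus_diag_uniq.
  apply (gegenbauer_ode_unique n (INR m) (INR d * (INR d + 2 * INR m + 1))
    (fun t => H0 t - H0 1 * gpoly d m t) (fun t => H1 t - H0 1 * Y1 t)
    (fun t => H2 t - H0 1 * Y2 t)); auto.
  - apply pos_INR.
  - intros u; apply @is_derive_minus; [apply D0|].
    apply is_derive_scal, E1.
  - intros u; apply @is_derive_minus; [apply D1|].
    apply is_derive_scal, E2.
  - intros u; specialize (Ode u); specialize (Yode u).
    transitivity (((1 - u ^ 2) * H2 u - 2 * (INR m + 1) * u * H1 u
             + INR d * (INR d + 2 * INR m + 1) * H0 u) - H0 1 *
      ((1 - u ^ 2) * Y2 u - 2 * (INR m + 1) * u * Y1 u
     + INR d * (INR d + 2 * INR m + 1) * gpoly d m u)); [ring|].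
    rewrite Ode, Yode; ring.
  - rewrite gpoly_1; ring.
Qed.

(** The derivative solves the equation for [(d, m + 1)], hence is a multiple of [gpoly d (S m)]. The
    factor is its value at 1, which the equation of [gpoly (S d) m] yields at [t = 1], where the
    second-order term drops out. *)
Lemma gpoly_derive d m t :
  is_derive (gpoly (S d) m) t
    (INR (S d) * (INR (S d) + 2 * INR m + 1) / (2 * (INR m + 1))
     * gpoly d (S m) t).
Proof.
  destruct (gpoly_ode (S d) m) as [Y1 [Y2 [E1 [E2 Yode]]]].
  assert (P1 : polynomial Y1) by (apply (polynomial_derive (gpoly (S d) m)); auto with poly).
  assert (P2 : polynomial Y2) by (apply (polynomial_derive Y1); auto with poly).
  destruct (polynomial_ex_derive Y2 P2) as [Y3 E3].
  pose proof (pos_INR m) as Hm.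
  assert (V : Y1 1 = INR (S d) * (INR (S d) + 2 * INR m + 1) / (2 * (INR m + 1))).
  { specialize (Yode 1); rewrite gpoly_1 in Yode.
    apply Rmult_eq_reg_l with (2 * (INR m + 1)); [|lra].
    transitivity (INR (S d) * (INR (S d) + 2 * INR m + 1)); [lra|field; lra]. }
  rewrite <- V, <- (gpoly_eigen_unique d (S m) Y1 Y2 Y3); auto.
  intros u.
  pose proof (gegenbauer_ode_derive _ _ _ _ _ _ E1 E2 E3 Yode u) as Q.
  rewrite <- Q, !S_INR; ring.
Qed.

(** * Beta integrals and moments of the eigenpolynomials *)

Lemma is_derive_pow_weight j k (t : R) :
  is_derive (fun t => t ^ j * (1 - t ^ 2) ^ k) t
    (INR j * t ^ pred j * (1 - t ^ 2) ^ k
     - 2 * INR k * t * t ^ j * (1 - t ^ 2) ^ pred k).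
Proof. auto_derive; auto; replace (1 + - (t * (t * 1))) with (1 - t ^ 2) by ring; ring. Qed.

(** For even [k] this is the Beta value B((k+1)/2, n+1). *)
Definition beta_mom (k n : nat) : R :=
  RInt (fun t => t ^ k * (1 - t ^ 2) ^ n) (-1) 1.

(** The derivative of [t^(k+1) (1-t^2)^(n+1)] integrates to 0, since the weight vanishes at both
    ends. *)
Lemma beta_mom_S k n : (INR k + 1) * beta_mom k (S n)
  = 2 * INR (S n) * beta_mom (S (S k)) n.
Proof.
  unfold beta_mom.
  apply Rminus_diag_uniq; rewrite <- RInt_lincomb by auto 10 with poly.
  rewrite (polynomial_RInt_derive (fun t => t ^ S k * (1 - t ^ 2) ^ S n)).
  - simpl; ring.
  - auto with poly.
  - intros t; evar_last; [apply is_derive_pow_weight|].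
    eqR; simpl pred; rewrite !S_INR; simpl pow; ring.
Qed.

Fixpoint rpoch (a : R) (k : nat) : R :=
  match k with O => 1 | S k' => rpoch a k' * (a + INR k') end.

Lemma rpoch_pos a k : 0 < a -> 0 < rpoch a k.
Proof.
  intros Ha; induction k; simpl; [lra|].
  apply Rmult_lt_0_compat; auto; pose proof (pos_INR k); lra.
Qed.

Lemma rpoch_add a j k : rpoch a (j + k) = rpoch a j * rpoch (a + INR j) k.
Proof.
  induction k as [|k IH]; [rewrite Nat.add_0_r; simpl; ring|].
  rewrite Nat.add_succ_r; simpl; rewrite IH, plus_INR; ring.
Qed.

Lemma RInt_pow k : RInt (fun t => t ^ k) (-1) 1 = (1 - (-1) ^ S k) / (INR k + 1).
Proof.
  pose proof (pos_INR k).
  rewrite (polynomial_RInt_derive (fun t => / (INR k + 1) * t ^ S k)).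
  - eqR; rewrite pow1; field; lra.
  - auto with poly.
  - intros t; evar_last.
    + apply @is_derive_scal, (is_derive_pow (fun t => t) (S k)), is_derive_id.
    + eqR; simpl pred; rewrite S_INR; unfold one; simpl; field; lra.
Qed.

Lemma beta_mom_even i n :
  beta_mom (2 * i) n = INR (fact n) / rpoch (INR i + / 2) (S n).
Proof.
  revert i; induction n as [|n IH]; intros i.
  - unfold beta_mom; rewrite (RInt_ext _ (fun t => t ^ (2 * i))) by (intros; eqR; simpl; ring).
    rewrite RInt_pow, pow_1_odd, mult_INR.
    pose proof (pos_INR i); eqR; simpl; field; lra.
  - pose proof (beta_mom_S (2 * i) n) as E.
    replace (S (S (2 * i))) with (2 * S i)%nat in E by lia.
    rewrite IH in E.
    pose proof (pos_INR i) as Hi; rewrite mult_INR in E; change (INR 2) with 2 in E.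
    apply Rmult_eq_reg_l with (2 * INR i + 1); [|lra].
    rewrite E.
    replace (rpoch (INR i + / 2) (S (S n)))
      with ((INR i + / 2) * rpoch (INR (S i) + / 2) (S n)).
    2:{ replace (S (S n)) with (1 + S n)%nat by lia; rewrite rpoch_add, S_INR.
        replace (INR i + / 2 + INR 1) with (INR i + 1 + / 2) by (simpl; ring).
        simpl; ring. }
    rewrite fact_simpl, mult_INR.
    pose proof (rpoch_pos (INR (S i) + / 2) (S n)) as Hr.
    assert (0 < INR (S i) + / 2) by (pose proof (pos_INR (S i)); lra).
    field; repeat split; try lra; apply Rgt_not_eq, Hr; auto.
Qed.

Lemma beta_mom_odd i n : beta_mom (2 * i + 1) n = 0.
Proof.
  revert i; induction n as [|n IH]; intros i.
  - unfold beta_mom; rewrite (RInt_ext _ (fun t => t ^ (2 * i + 1))) by (intros; eqR; simpl; ring).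
    rewrite RInt_pow; replace (S (2 * i + 1)) with (2 * S i)%nat by lia.
    rewrite pow_1_even; unfold Rdiv; ring.
  - pose proof (beta_mom_S (2 * i + 1) n) as E.
    replace (S (S (2 * i + 1))) with (2 * S i + 1)%nat in E by lia.
    rewrite IH in E.
    pose proof (pos_INR (2 * i + 1)); nra.
Qed.

Definition gmom (d m N : nat) : R :=
  RInt (fun t => t ^ N * ((1 - t ^ 2) ^ m * gpoly d m t)) (-1) 1.

(** Sturm-Liouville form of the equation: [(1-t^2)^m] times the operator is a total derivative. It
    serves the integration by parts in [gmom_S]. *)
Lemma gpoly_divergence_form d m t :
  exists Y1 : R -> R, (forall t : R, is_derive (gpoly d m) t (Y1 t)) /\
  is_derive (fun t => (1 - t ^ 2) ^ S m * Y1 t) t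
    (- (INR d * (INR d + 2 * INR m + 1)) * ((1 - t ^ 2) ^ m * gpoly d m t)).
Proof.
  destruct (gpoly_ode d m) as [Y1 [Y2 [E1 [E2 Yode]]]].
  exists Y1; split; auto.
  (* The factor [t ^ 0] brings the weight into the shape of [is_derive_pow_weight]. *)
  apply (is_derive_ext (fun t => (t ^ 0 * (1 - t ^ 2) ^ S m) * Y1 t));
    [intros; eqR; simpl; ring|].
  evar_last.
  { apply @is_derive_mult; [apply is_derive_pow_weight|apply E2|intros; apply Rmult_comm]. }
  unfold plus, mult; eqR; simpl AbsRing.sort; simpl plus; simpl mult.
  specialize (Yode t); rewrite S_INR; simpl pred.
  transitivity ((1 - t ^ 2) ^ m * ((1 - t ^ 2) * Y2 t - 2 * (INR m + 1) * t * Y1 t)).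
  - simpl; ring.
  - replace ((1 - t ^ 2) * Y2 t - 2 * (INR m + 1) * t * Y1 t) with
      (- (INR d * (INR d + 2 * INR m + 1)) * gpoly d m t) by lra; ring.
Qed.

(** One integration by parts: the weighted polynomial is, up to its eigenvalue [E], minus the
    derivative of [(1-t^2)^(m+1)] times a multiple of [gpoly d (S m)]. The eigenvalue also sits in
    that multiple and cancels. At [N = 0] the factor [INR N] makes the value of [pred N]
    irrelevant. *)
Lemma gmom_S d m N :
  gmom (S d) m N = INR N / (2 * (INR m + 1)) * gmom d (S m) (pred N).
Proof.
  set (E := INR (S d) * (INR (S d) + 2 * INR m + 1)).
  pose proof (pos_INR m) as Hm.
  assert (HE : 0 < E).
  { unfold E; rewrite S_INR; pose proof (pos_INR d); nra. }
  set (K := E / (2 * (INR m + 1))).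
  unfold gmom.
  apply Rmult_eq_reg_l with E; [|lra].
  apply Rminus_diag_uniq.
  replace (E * (INR N / (2 * (INR m + 1)) * _)) with (INR N * K *
    RInt (fun t => t ^ pred N * ((1 - t ^ 2) ^ S m * gpoly d (S m) t)) (-1) 1)
    by (unfold K; field; lra).
  rewrite <- RInt_lincomb by auto 10 with poly.
  rewrite (polynomial_RInt_derive
    (fun t => - (t ^ N * ((1 - t ^ 2) ^ S m * (K * gpoly d (S m) t))))).
  - simpl; ring.
  - auto 10 with poly.
  - intros t.
    destruct (gpoly_divergence_form (S d) m t) as [Y1 [D1 Dv]].
    fold E in Dv.
    assert (HY : forall u, Y1 u = K * gpoly d (S m) u).
    { intros u; rewrite <- (is_derive_unique _ _ _ (D1 u)).
      apply is_derive_unique, gpoly_derive. }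
    apply (is_derive_ext (fun t => - (t ^ N * ((1 - t ^ 2) ^ S m * Y1 t)))).
    { intros u; rewrite HY; reflexivity. }
    evar_last.
    + apply @is_derive_opp, @is_derive_mult; [|exact Dv|intros; apply Rmult_comm].
      auto_derive; auto; reflexivity.
    + unfold opp, plus, mult; simpl; rewrite HY; ring.
Qed.

Lemma gmom_low d m N : (N < d)%nat -> gmom d m N = 0.
Proof.
  revert m N; induction d as [|d IH]; intros m N H; [lia|].
  rewrite gmom_S; destruct N as [|N]; [simpl; unfold Rdiv; ring|].
  rewrite IH; [ring|simpl; lia].
Qed.

(** After [d] integrations by parts the polynomial has become constant, and a Beta integral with
    weight exponent [m + d] remains. *)
Lemma gmom_high d m j :
  gmom d m (d + j) = INR (fact (d + j)) * INR (fact m)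
    / (INR (fact j) * 2 ^ d * INR (fact (m + d))) * beta_mom j (m + d).
Proof.
  revert m; induction d as [|d IH]; intros m.
  - unfold gmom, beta_mom; rewrite Nat.add_0_r; simpl Nat.add.
    rewrite (RInt_ext _ (fun t => t ^ j * (1 - t ^ 2) ^ m)).
    + simpl pow; match goal with |- ?y = _ => set (b := y : R) end.
      change (b = INR (fact j) * INR (fact m)
        / (INR (fact j) * 1 * INR (fact m)) * b).
      field; split; apply INR_fact_neq_0.
    + intros t _; eqR; unfold gpoly, gpart; simpl; ring.
  - rewrite gmom_S; simpl Nat.add; simpl pred; rewrite IH.
    replace (m + S d)%nat with (S m + d)%nat by lia.
    rewrite (fact_simpl (d + j)), (fact_simpl m), !mult_INR.
    pose proof (pos_INR m).
    rewrite (S_INR m); simpl pow; field; repeat split; try apply INR_fact_neq_0; try lra.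
    apply pow_nonzero; lra.
Qed.

(** * The polynomial kernel *)

Definition kterm (N k : nat) (t : R) : R := t ^ (N - 2 * k) * (1 - t ^ 2) ^ k.

(** The value 0 for [2 k > N], where [N - 2 * k] is truncated, lets every sum run up to [N]. *)
Definition kcoef (m N k : nat) : R :=
  if (2 * k <=? N)%nat
  then / (4 ^ k * INR (fact k) * INR (fact (m + k)) * INR (fact (N - 2 * k)))
  else 0.

(** Up to a constant depending on [m], this is the integral of [(t s + sqrt(1-t^2) sqrt(1-s^2) cos
    phi)^N / N!] over [0 < phi < pi] with weight [sin(phi)^(2m)]: only even powers of [cos phi]
    survive, and their moments produce [4^k k! (m+k)!]. It is thus a zonal kernel for the Gegenbauer
    parameter [m + 1/2]. *)
Definition kernel (m N : nat) (t s : R) : R :=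
  sum_f_R0 (fun k => kcoef m N k * kterm N k t * kterm N k s) N.

Lemma kterm_polynomial N k : polynomial (kterm N k).
Proof. unfold kterm; auto 10 with poly. Qed.

#[local] Hint Resolve kterm_polynomial : poly.

(** The identity also holds at the cut-off: for [N = 2 k] and [N = 2 k + 1] the factor on the right
    vanishes, in agreement with [kcoef m N (S k) = 0]. *)
Lemma kcoef_S m N k :
  4 * INR (S k) * (INR (S k) + INR m) * kcoef m N (S k)
  = kcoef m N k * ((INR N - 2 * INR k) * (INR N - 2 * INR k - 1)).
Proof.
  unfold kcoef.
  destruct (Nat.leb_spec (2 * S k) N) as [H|H].
  - destruct (Nat.leb_spec (2 * k) N) as [H'|H']; [|lia].
    assert (EN : N = (2 * k + S (S (N - 2 * S k)))%nat) by lia.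
    replace (N - 2 * k)%nat with (S (S (N - 2 * S k))) by lia.
    set (j := (N - 2 * S k)%nat) in *.
    replace (INR N) with (2 * INR k + INR j + 2)
      by (rewrite EN, plus_INR, mult_INR, !S_INR; simpl; ring).
    replace (m + S k)%nat with (S (m + k)) by lia.
    rewrite !fact_simpl, !mult_INR, !S_INR, plus_INR.
    pose proof (pos_INR k); pose proof (pos_INR m); pose proof (pos_INR j).
    simpl pow; field; repeat split; try apply INR_fact_neq_0; try lra.
    apply pow_nonzero; lra.
  - destruct (Nat.leb_spec (2 * k) N) as [H'|H']; [|ring].
    assert (D : N = (2 * k)%nat \/ N = (2 * k + 1)%nat) by lia.
    destruct D as [-> | ->]; rewrite ?plus_INR, mult_INR; simpl INR; ring.
Qed.

Lemma kterm_ode m N k : (2 * k <= N)%nat -> exists f1 f2 : R -> R,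
  (forall t : R, is_derive (kterm N k) t (f1 t)) /\
  (forall t : R, is_derive f1 t (f2 t)) /\
  (forall t, (1 - t ^ 2) * f2 t - 2 * (INR m + 1) * t * f1 t
   = (INR N - 2 * INR k) * (INR N - 2 * INR k - 1) * kterm (N - 2) k t
     + 4 * INR k * (INR k + INR m) * kterm (N - 2) (pred k) t
     - INR N * (INR N + 2 * INR m + 1) * kterm N k t).
Proof.
  intros H.
  replace (INR N - 2 * INR k) with (INR (N - 2 * k))
    by (rewrite minus_INR, mult_INR by lia; simpl; ring).
  replace (INR N) with (INR (N - 2 * k) + 2 * INR k)
    by (rewrite minus_INR, mult_INR by lia; simpl; ring).
  unfold kterm.
  replace (N - 2 - 2 * k)%nat with (N - 2 * k - 2)%nat by lia.
  (* For [k > 0] the two exponents of [t] agree; at [k = 0] the prefactor is 0. *)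
  assert (Hk : forall t, 4 * INR k * (INR k + INR m)
     * (t ^ (N - 2 - 2 * pred k) * (1 - t ^ 2) ^ pred k)
     = 4 * INR k * (INR k + INR m) * (t ^ (N - 2 * k) * (1 - t ^ 2) ^ pred k)).
  { intros t; destruct k as [|k]; [simpl; ring|].
    simpl pred; replace (N - 2 - 2 * k)%nat with (N - 2 * S k)%nat by lia; ring. }
  set (j := (N - 2 * k)%nat) in *.
  exists (fun t => INR j * (t ^ pred j * (1 - t ^ 2) ^ k)
     - 2 * INR k * (t ^ S j * (1 - t ^ 2) ^ pred k)),
   (fun t => INR j * (INR (pred j) * t ^ pred (pred j) * (1 - t ^ 2) ^ k
       - 2 * INR k * t * t ^ pred j * (1 - t ^ 2) ^ pred k)
     - 2 * INR k * (INR (S j) * t ^ j * (1 - t ^ 2) ^ pred k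
       - 2 * INR (pred k) * t * t ^ S j * (1 - t ^ 2) ^ pred (pred k))).
  split; [|split].
  - intros t; evar_last; [apply is_derive_pow_weight|].
    eqR; simpl pow; ring.
  - intros t; apply @is_derive_minus; apply is_derive_scal, is_derive_pow_weight.
  - intros t; rewrite Hk.
    destruct j as [|[|j]]; destruct k as [|[|k]]; simpl pred; simpl Nat.sub;
      rewrite ?Nat.sub_0_r, ?S_INR; simpl pow; simpl INR; ring.
Qed.

(** Summation by parts: [kcoef_S] turns the terms with [pred k] into terms one index lower, where
    they meet [a k] with [a (S k)]. The shift leaves one boundary term, which [kcoef_top] kills at
    [K = N]. *)
Lemma kcoef_sum m N K (a b : nat -> R) :
  sum_f_R0 (fun k => kcoef m N k * a k *
    ((INR N - 2 * INR k) * (INR N - 2 * INR k - 1) * b k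
     + 4 * INR k * (INR k + INR m) * b (pred k))) K
  = sum_f_R0 (fun k => kcoef m N k * ((INR N - 2 * INR k) * (INR N - 2 * INR k - 1))
      * (a k + a (S k)) * b k) K
    - kcoef m N K * ((INR N - 2 * INR K) * (INR N - 2 * INR K - 1)) * a (S K) * b K.
Proof.
  induction K as [|K IH]; [simpl; ring|].
  rewrite !tech5, IH; simpl pred.
  rewrite <- (kcoef_S m N K); ring.
Qed.

Lemma kcoef_top m N :
  kcoef m N N * ((INR N - 2 * INR N) * (INR N - 2 * INR N - 1)) = 0.
Proof.
  unfold kcoef; destruct (Nat.leb_spec (2 * N) N) as [H|H]; [|ring].
  replace N with O by lia; simpl; ring.
Qed.

(** This is [t^2 + (1 - t^2) = 1]; the coefficient vanishes when fewer than two powers of [t] are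
    available. Inserted in [kcoef_sum], it leaves terms of level [N - 2] in both variables, a
    symmetric expression. *)
Lemma kterm_split m N k t :
  kcoef m N k * ((INR N - 2 * INR k) * (INR N - 2 * INR k - 1))
    * (kterm N k t + kterm N (S k) t)
  = kcoef m N k * ((INR N - 2 * INR k) * (INR N - 2 * INR k - 1))
    * kterm (N - 2) k t.
Proof.
  rewrite <- kcoef_S; unfold kcoef.
  destruct (Nat.leb_spec (2 * S k) N) as [H|H]; [|ring].
  unfold kterm.
  replace (N - 2 * k)%nat with (S (S (N - 2 * S k))) by lia.
  replace (N - 2 - 2 * k)%nat with (N - 2 * S k)%nat by lia.
  simpl pow; ring.
Qed.

Lemma kterm_sum_ode m N K (e : nat -> R) :
  (forall k, (N < 2 * k)%nat -> e k = 0) -> exists F1 F2 : R -> R,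
  (forall t : R, is_derive (fun s => sum_f_R0 (fun k => e k * kterm N k s) K) t (F1 t)) /\
  (forall t : R, is_derive F1 t (F2 t)) /\
  (forall t, (1 - t ^ 2) * F2 t - 2 * (INR m + 1) * t * F1 t
   = sum_f_R0 (fun k => e k *
      ((INR N - 2 * INR k) * (INR N - 2 * INR k - 1) * kterm (N - 2) k t
       + 4 * INR k * (INR k + INR m) * kterm (N - 2) (pred k) t)) K
     - INR N * (INR N + 2 * INR m + 1) * sum_f_R0 (fun k => e k * kterm N k t) K).
Proof.
  intros He.
  assert (T : forall k, exists f1 f2 : R -> R,
    (forall t : R, is_derive (fun s => e k * kterm N k s) t (f1 t)) /\
    (forall t : R, is_derive f1 t (f2 t)) /\
    (forall t, (1 - t ^ 2) * f2 t - 2 * (INR m + 1) * t * f1 t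
     = e k * ((INR N - 2 * INR k) * (INR N - 2 * INR k - 1) * kterm (N - 2) k t
       + 4 * INR k * (INR k + INR m) * kterm (N - 2) (pred k) t)
       - INR N * (INR N + 2 * INR m + 1) * (e k * kterm N k t))).
  { intros k; destruct (Compare_dec.le_lt_dec (2 * k) N) as [L|L].
    - destruct (kterm_ode m N k L) as [f1 [f2 [D1 [D2 O]]]].
      exists (fun t => e k * f1 t), (fun t => e k * f2 t); split; [|split].
      + intros t; apply is_derive_scal, D1.
      + intros t; apply is_derive_scal, D2.
      + intros t; specialize (O t).
        transitivity (e k * ((1 - t ^ 2) * f2 t - 2 * (INR m + 1) * t * f1 t));
          [ring|rewrite O; ring].
    - exists (fun _ => 0), (fun _ => 0); rewrite (He k L); split; [|split].
      + intros t; apply (is_derive_ext (fun _ => 0)); [intros; eqR; ring|].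
        apply @is_derive_const.
      + intros t; apply @is_derive_const.
      + intros t; ring. }
  induction K as [|K [F1 [F2 [D1 [D2 O]]]]].
  - destruct (T O) as [f1 [f2 [D1 [D2 O]]]]; exists f1, f2; split; [|split]; auto.
  - destruct (T (S K)) as [f1 [f2 [d1 [d2 o]]]].
    exists (fun t => F1 t + f1 t), (fun t => F2 t + f2 t); split; [|split].
    + intros t; simpl sum_f_R0; apply @is_derive_plus; [apply D1|apply d1].
    + intros t; apply @is_derive_plus; [apply D2|apply d2].
    + intros t; rewrite !tech5; specialize (O t); specialize (o t).
      transitivity (((1 - t ^ 2) * F2 t - 2 * (INR m + 1) * t * F1 t)
        + ((1 - t ^ 2) * f2 t - 2 * (INR m + 1) * t * f1 t)); [ring|].
      rewrite O, o; ring.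
Qed.

(** * Integrals of the kernel against the eigenpolynomial *)

Definition gint (d m : nat) (f : R -> R) : R :=
  RInt (fun t => f t * ((1 - t ^ 2) ^ m * gpoly d m t)) (-1) 1.

Lemma gint_ext d m f g : (forall t, f t = g t) -> gint d m f = gint d m g.
Proof. intros H; apply RInt_ext; intros t _; rewrite H; reflexivity. Qed.

Lemma gint_lincomb d m f g u v : polynomial f -> polynomial g ->
  gint d m (fun t => u * f t - v * g t) = u * gint d m f - v * gint d m g.
Proof.
  intros Hf Hg; unfold gint; rewrite <- RInt_lincomb by auto 10 with poly.
  apply RInt_ext; intros t _; eqR; ring.
Qed.

Lemma gint_plus d m f g : polynomial f -> polynomial g ->
  gint d m (fun t => f t + g t) = gint d m f + gint d m g.
Proof.
  intros Hf Hg.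
  rewrite (gint_ext d m _ (fun t => 1 * f t - (-1) * g t)) by (intros; ring).
  rewrite gint_lincomb by auto; ring.
Qed.

Lemma gint_scal d m f u : polynomial f ->
  gint d m (fun t => u * f t) = u * gint d m f.
Proof.
  intros Hf.
  rewrite (gint_ext d m _ (fun t => u * f t - 0 * f t)) by (intros; ring).
  rewrite gint_lincomb by auto; ring.
Qed.

Lemma gint_sum d m (f : nat -> R -> R) K : (forall k, polynomial (f k)) ->
  gint d m (fun t => sum_f_R0 (fun k => f k t) K)
  = sum_f_R0 (fun k => gint d m (f k)) K.
Proof.
  intros Hf; induction K as [|K IH]; simpl; [reflexivity|].
  rewrite gint_plus by auto with poly; rewrite IH; reflexivity.
Qed.

(** Green's identity: the difference of the two sides integrates the derivative of
    [(1-t^2)^(m+1) (f' Y - f Y')], which is 0 at both ends. *)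
Lemma gint_selfadjoint d m (f f1 f2 : R -> R) : polynomial f ->
  (forall t : R, is_derive f t (f1 t)) -> (forall t : R, is_derive f1 t (f2 t)) ->
  gint d m (fun t => (1 - t ^ 2) * f2 t - 2 * (INR m + 1) * t * f1 t)
  = - (INR d * (INR d + 2 * INR m + 1)) * gint d m f.
Proof.
  intros Pf D1 D2.
  destruct (gpoly_ode d m) as [Y1 [Y2 [E1 [E2 Yode]]]].
  assert (P1 : polynomial f1) by (apply (polynomial_derive f); auto).
  assert (P2 : polynomial f2) by (apply (polynomial_derive f1); auto).
  assert (Q1 : polynomial Y1) by (apply (polynomial_derive (gpoly d m)); auto with poly).
  set (E := INR d * (INR d + 2 * INR m + 1)) in *.
  apply Rminus_diag_uniq.
  (* The coefficient 1 gives the difference the form expected by [gint_lincomb]. *)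
  rewrite <- (Rmult_1_l (gint d m (fun t => _ - _))).
  rewrite <- gint_lincomb by auto 10 with poly.
  unfold gint.
  rewrite (polynomial_RInt_derive
    (fun t => (t ^ 0 * (1 - t ^ 2) ^ S m) * (f1 t * gpoly d m t - f t * Y1 t))).
  - eqR; simpl; ring.
  - auto 10 with poly.
  - intros t; evar_last.
    + apply @is_derive_mult; [apply is_derive_pow_weight| |intros; apply Rmult_comm].
      apply @is_derive_minus; (apply @is_derive_mult; [| |intros; apply Rmult_comm]);
        [apply D2|apply E1|apply D1|apply E2].
    + unfold minus, opp, plus, mult; eqR; simpl AbsRing.sort; simpl.
      specialize (Yode t).
      change (match m with O => 1 | S _ => INR m + 1 end) with (INR (S m)).
      rewrite S_INR.
      transitivity ((1 - t ^ 2) ^ m * (((1 - t ^ 2) * f2 t - 2 * (INR m + 1) * t * f1 t) * gpoly d m t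
        - f t * ((1 - t ^ 2) * Y2 t - 2 * (INR m + 1) * t * Y1 t)));
        [simpl; ring|].
      replace ((1 - t ^ 2) * Y2 t - 2 * (INR m + 1) * t * Y1 t) with
        (- E * gpoly d m t) by lra.
      simpl; ring.
Qed.

Lemma kernel_at_1 m N t : kernel m N t 1 = t ^ N / (INR (fact m) * INR (fact N)).
Proof.
  unfold kernel.
  assert (H : forall K, sum_f_R0 (fun k => kcoef m N k * kterm N k t * kterm N k 1) K
    = t ^ N / (INR (fact m) * INR (fact N))).
  { induction K as [|K IH].
    - unfold kcoef, kterm; simpl; rewrite Nat.add_0_r, Nat.sub_0_r, pow1.
      field; split; apply INR_fact_neq_0.
    - rewrite tech5, IH; unfold kterm; simpl pow; ring. }
  apply H.
Qed.

(** A Funk-Hecke formula: integration against the zonal kernel multiplies the eigenpolynomial by a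
    scalar. *)
Lemma kernel_eigen d m N s :
  gint d m (fun t => kernel m N t s)
  = gmom d m N / (INR (fact m) * INR (fact N)) * gpoly d m s.
Proof.
  (* The kernel is a finite sum of products, so its integral is an explicit polynomial in [s] with
     coefficients [kcoef * lam], and no differentiation under the integral sign occurs. *)
  set (lam := fun k => gint d m (kterm N k)).
  assert (HF : forall s, gint d m (fun t => kernel m N t s)
    = sum_f_R0 (fun k => kcoef m N k * lam k * kterm N k s) N).
  { intros u; unfold kernel.
    rewrite gint_sum by auto 10 with poly.
    apply sum_eq; intros k _; unfold lam.
    rewrite (gint_ext d m _ (fun t => (kcoef m N k * kterm N k u) * kterm N k t))
      by (intros; ring).
    rewrite gint_scal by auto with poly; ring. }
  assert (Z : forall k, (N < 2 * k)%nat -> kcoef m N k = 0).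
  { intros k Hk; unfold kcoef; destruct (Nat.leb_spec (2 * k) N); [lia|reflexivity]. }
  destruct (kterm_sum_ode m N N (fun k => kcoef m N k * lam k)) as [F1 [F2 [D1 [D2 O]]]].
  { intros k Hk; rewrite Z by exact Hk; ring. }
  rewrite HF.
  rewrite (gpoly_eigen_unique d m
    (fun s => sum_f_R0 (fun k => kcoef m N k * lam k * kterm N k s) N) F1 F2); auto.
  - rewrite <- HF; f_equal; unfold gmom.
    rewrite (gint_ext d m _ (fun t => / (INR (fact m) * INR (fact N)) * t ^ N))
      by (intros t; rewrite kernel_at_1; unfold Rdiv; ring).
    rewrite gint_scal by auto with poly; unfold gint, Rdiv; ring.
  - auto 10 with poly.
  - intros t; rewrite O.
    (* [L] may be moved from [t] to the integration variable because both
       versions reduce to the same sum by [kcoef_sum] and [kterm_split]. *)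
    rewrite (kcoef_sum m N N lam (fun k => kterm (N - 2) k t)), kcoef_top.
    rewrite (sum_eq _ (fun k => kcoef m N k
      * ((INR N - 2 * INR k) * (INR N - 2 * INR k - 1)
         * gint d m (kterm (N - 2) k)) * kterm (N - 2) k t)).
    2:{ intros k _; f_equal; unfold lam.
        rewrite <- gint_plus, <- !gint_scal by auto 10 with poly.
        apply gint_ext; intros u; rewrite kterm_split; ring. }
    assert (S2 : sum_f_R0 (fun k => kcoef m N k
      * ((INR N - 2 * INR k) * (INR N - 2 * INR k - 1)
         * gint d m (kterm (N - 2) k)) * kterm (N - 2) k t) N
      = sum_f_R0 (fun k => kcoef m N k * kterm N k t *
        ((INR N - 2 * INR k) * (INR N - 2 * INR k - 1) * gint d m (kterm (N - 2) k)
         + 4 * INR k * (INR k + INR m) * gint d m (kterm (N - 2) (pred k)))) N).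
    { rewrite (kcoef_sum m N N (fun k => kterm N k t)), kcoef_top.
      rewrite Rmult_0_l, Rmult_0_l, Rminus_0_r.
      apply sum_eq; intros k _; rewrite kterm_split; ring. }
    rewrite S2.
    rewrite (sum_eq _ (fun k => kcoef m N k * lam k * kterm N k t
      * (INR N * (INR N + 2 * INR m + 1) - INR d * (INR d + 2 * INR m + 1)))).
    { rewrite <- (scal_sum (fun k => kcoef m N k * lam k * kterm N k t)); ring. }
    intros k _.
    destruct (Compare_dec.le_lt_dec (2 * k) N) as [L|L]; [|rewrite Z by exact L; ring].
    destruct (kterm_ode m N k L) as [f1 [f2 [d1 [d2 o]]]].
    (* Self-adjointness expresses the integrals of level [N - 2] through [lam k]; the factor
       obtained is the difference of the eigenvalues belonging to [N] and [d], the same for every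
       [k]. *)
    pose proof (gint_selfadjoint d m _ _ _ (kterm_polynomial N k) d1 d2) as SA.
    rewrite (gint_ext d m _ (fun t => 1 * ((INR N - 2 * INR k) * (INR N - 2 * INR k - 1)
         * kterm (N - 2) k t
         + 4 * INR k * (INR k + INR m) * kterm (N - 2) (pred k) t)
       - INR N * (INR N + 2 * INR m + 1) * kterm N k t)) in SA
      by (intros u; rewrite o; ring).
    rewrite gint_lincomb, gint_plus, !gint_scal in SA by auto 10 with poly.
    rewrite Rmult_1_l in SA; fold (lam k) in SA.
    replace (_ + _) with
      ((INR N * (INR N + 2 * INR m + 1) - INR d * (INR d + 2 * INR m + 1)) * lam k)
      by lra.
    ring.
Qed.

(** * Normalised moments and the size of the kernel *)

Lemma fact_double k : INR (fact (2 * k)) = 4 ^ k * INR (fact k) * rpoch (/ 2) k.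
Proof.
  induction k as [|k IH]; [simpl; ring|].
  replace (2 * S k)%nat with (S (S (2 * k))) by lia.
  rewrite !fact_simpl, !mult_INR, IH, !S_INR, mult_INR; simpl; field.
Qed.

Lemma fact_double_le k : INR (fact (2 * k)) <= 4 ^ k * INR (fact k) * INR (fact k).
Proof.
  rewrite fact_double; apply Rmult_le_compat_l.
  - apply Rmult_le_pos; [apply pow_le; lra|apply pos_INR].
  - induction k as [|k IH]; [simpl; lra|].
    rewrite fact_simpl, mult_INR, S_INR; simpl rpoch.
    pose proof (pos_INR k); pose proof (rpoch_pos (/ 2) k ltac:(lra)).
    rewrite (Rmult_comm (INR k + 1)); apply Rmult_le_compat; lra.
Qed.

Lemma gmom_odd d m k : gmom d m (d + (2 * k + 1)) = 0.
Proof. rewrite gmom_high, beta_mom_odd; ring. Qed.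

(** The factor [(1/2)_k] of [(2k)!] and [(k+1/2)_(m+d+1)] of the Beta integral merge into
    [(1/2)_(m+d+1+k)], which is [Gamma(m+d+k+3/2) / sqrt PI]: the denominator of the series on the
    right-hand side. *)
Lemma gmom_even d m k :
  gmom d m (d + 2 * k) / (INR (fact m) * INR (fact (d + 2 * k)))
  = / (2 ^ (d + 2 * k) * INR (fact k) * rpoch (/ 2) (m + d + 1 + k)).
Proof.
  rewrite gmom_high, beta_mom_even, fact_double.
  replace (m + d + 1 + k)%nat with (k + S (m + d))%nat by lia.
  rewrite rpoch_add, pow_add, pow_mult, (Rplus_comm (/ 2)).
  replace (2 ^ 2) with 4 by ring.
  pose proof (pos_INR k).
  assert (0 < rpoch (/ 2) k) by (apply rpoch_pos; lra).
  assert (0 < rpoch (INR k + / 2) (S (m + d))) by (apply rpoch_pos; lra).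
  assert (0 < 2 ^ d) by (apply pow_lt; lra).
  assert (0 < 4 ^ k) by (apply pow_lt; lra).
  field; repeat split; try apply INR_fact_neq_0; lra.
Qed.

Lemma kcoef_le m N k : (2 * k <= N)%nat ->
  kcoef m N k <= / (INR (fact (2 * k)) * INR (fact (N - 2 * k))).
Proof.
  intros H; unfold kcoef; destruct (Nat.leb_spec (2 * k) N); [|lia].
  apply Rinv_le_contravar.
  - apply Rmult_lt_0_compat; apply INR_fact_lt_0.
  - apply Rmult_le_compat_r; [apply pos_INR|].
    eapply Rle_trans; [apply fact_double_le|].
    apply Rmult_le_compat_l; [|apply le_INR, fact_le; lia].
    apply Rmult_le_pos; [apply pow_le; lra|apply pos_INR].
Qed.

Lemma kcoef_pos m N k : 0 <= kcoef m N k.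
Proof.
  unfold kcoef; destruct (_ <=? _)%nat; [|lra].
  apply Rlt_le, Rinv_0_lt_compat.
  repeat apply Rmult_lt_0_compat; try apply INR_fact_lt_0; apply pow_lt; lra.
Qed.

Lemma sum_even_le (f : nat -> R) K : (forall i, 0 <= f i) ->
  sum_f_R0 (fun k => f (2 * k)%nat) K <= sum_f_R0 f (2 * K).
Proof.
  intros Hf; induction K as [|K IH]; [simpl; lra|].
  replace (2 * S K)%nat with (S (S (2 * K))) by lia.
  rewrite !tech5; replace (S (S (2 * K))) with (2 * S K)%nat by lia.
  pose proof (Hf (S (2 * K))); lra.
Qed.

(** Since [4^k k! (m+k)! >= (2k)!], the terms are dominated by the even-index terms of the binomial
    expansion of [(P + q)^N], divided by [N!]. *)
Lemma kcoef_sum_le m N P q : 0 <= P -> 0 <= q ->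
  sum_f_R0 (fun k => kcoef m N k * P ^ (N - 2 * k) * (q ^ 2) ^ k) N
  <= (P + q) ^ N / INR (fact N).
Proof.
  intros HP Hq.
  set (f := fun i => if (i <=? N)%nat
    then P ^ (N - i) * q ^ i / (INR (fact i) * INR (fact (N - i))) else 0).
  assert (Hf : forall i, 0 <= f i).
  { intros i; unfold f; destruct (_ <=? _)%nat; [|lra].
    apply Rmult_le_pos; [apply Rmult_le_pos; apply pow_le; auto|].
    apply Rlt_le, Rinv_0_lt_compat, Rmult_lt_0_compat; apply INR_fact_lt_0. }
  apply Rle_trans with (sum_f_R0 (fun k => f (2 * k)%nat) N).
  - apply sum_Rle; intros k _; unfold f.
    destruct (Nat.leb_spec (2 * k) N) as [H|H].
    + rewrite <- pow_mult, Rmult_assoc, Rmult_comm; apply Rmult_le_compat_l.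
      * apply Rmult_le_pos; apply pow_le; auto.
      * apply kcoef_le; auto.
    + unfold kcoef; destruct (Nat.leb_spec (2 * k) N); [lia|lra].
  - eapply Rle_trans; [apply sum_even_le, Hf|].
    (* [f] vanishes beyond [N], so the range [2 * N] forced by the even indices adds nothing. *)
    assert (E : forall j, sum_f_R0 f (N + j) = sum_f_R0 f N).
    { induction j as [|j IH]; [rewrite Nat.add_0_r; reflexivity|].
      rewrite Nat.add_succ_r, tech5, IH; unfold f at 2.
      destruct (Nat.leb_spec (S (N + j)) N); [lia|ring]. }
    replace (2 * N)%nat with (N + N)%nat by lia; rewrite E.
    rewrite Rplus_comm, binomial; unfold Rdiv; rewrite Rmult_comm, scal_sum.
    apply Req_le, sum_eq; intros i Hi; unfold f, Binomial.C.
    destruct (Nat.leb_spec i N); [|lia].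
    field; repeat split; apply INR_fact_neq_0.
Qed.

Lemma kernelE m N t s :
  kernel m N t s = sum_f_R0 (fun k => kcoef m N k * (t * s) ^ (N - 2 * k)
    * ((1 - t ^ 2) * (1 - s ^ 2)) ^ k) N.
Proof.
  apply sum_eq; intros k _; unfold kterm; rewrite !Rpow_mult_distr; ring.
Qed.

(** Each product is at most half the sum of the squares of its factors, and the four squares add up
    to 2. *)
Lemma Rabs_cos_sin_le a b : Rabs (cos a * cos b) + Rabs (sin a * sin b) <= 1.
Proof.
  pose proof (sin2_cos2 a) as Ha; pose proof (sin2_cos2 b) as Hb; unfold Rsqr in *.
  unfold Rabs; destruct (Rcase_abs _); destruct (Rcase_abs _);
    pose proof (Rle_0_sqr (cos a - cos b)); pose proof (Rle_0_sqr (sin a - sin b));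
    pose proof (Rle_0_sqr (cos a + cos b)); pose proof (Rle_0_sqr (sin a + sin b));
    unfold Rsqr in *; nra.
Qed.

Lemma kernel_abs_sum_le m N a b :
  sum_f_R0 (fun k => kcoef m N k * Rabs (cos a * cos b) ^ (N - 2 * k)
    * (Rabs (sin a * sin b) ^ 2) ^ k) N <= / INR (fact N).
Proof.
  eapply Rle_trans; [apply kcoef_sum_le; apply Rabs_pos|].
  rewrite <- (Rmult_1_l (/ _)); apply Rmult_le_compat_r.
  - apply Rlt_le, Rinv_0_lt_compat, INR_fact_lt_0.
  - rewrite <- (pow1 N); apply pow_incr; split; [|apply Rabs_cos_sin_le].
    apply Rplus_le_le_0_compat; apply Rabs_pos.
Qed.

Lemma kernel_le m N a b : Rabs (kernel m N (cos a) (cos b)) <= / INR (fact N).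
Proof.
  eapply Rle_trans; [|apply (kernel_abs_sum_le m N a b)].
  rewrite kernelE; eapply Rle_trans; [apply Rsum_abs|].
  apply sum_Rle; intros k _; apply Req_le.
  rewrite (Rabs_mult (_ * _)), (Rabs_mult (kcoef m N k)), <- !RPow_abs.
  rewrite (Rabs_right (kcoef _ _ _)) by (apply Rle_ge, kcoef_pos).
  f_equal; f_equal.
  replace (1 - cos a ^ 2) with (sin a ^ 2)
    by (pose proof (sin2_cos2 a); unfold Rsqr in *; simpl; lra).
  replace (1 - cos b ^ 2) with (sin b ^ 2)
    by (pose proof (sin2_cos2 b); unfold Rsqr in *; simpl; lra).
  rewrite <- Rpow_mult_distr; symmetry; apply RPow_abs.
Qed.

(** * Complex series *)

Lemma filterlim_C_iff (u : nat -> C) (l : C) :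
  filterlim u eventually (locally (T := C_UniformSpace) l) <->
  is_lim_seq (fun n => Re (u n)) (Re l) /\ is_lim_seq (fun n => Im (u n)) (Im l).
Proof.
  split.
  - intros H; split.
    + apply (filterlim_comp _ _ _ u fst _ _ _ H).
      intros P [e He]; exists e; intros [x y] [Hx _]; apply He, Hx.
    + apply (filterlim_comp _ _ _ u snd _ _ _ H).
      intros P [e He]; exists e; intros [x y] [_ Hy]; apply He, Hy.
  - intros [H1 H2] P [e He].
    apply is_lim_seq_spec in H1; apply is_lim_seq_spec in H2.
    specialize (H1 e); specialize (H2 e).
    destruct H1 as [N1 H1]; destruct H2 as [N2 H2].
    exists (N1 + N2)%nat; intros n Hn; apply He.
    split; [apply H1|apply H2]; lia.
Qed.

Lemma Re_sum_n (u : nat -> C) n :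
  Re (sum_n (G := C_NormedModule) u n) = sum_n (fun k => Re (u k)) n.
Proof.
  induction n as [|n IH]; [rewrite !sum_O; reflexivity|].
  rewrite !sum_Sn, <- IH; reflexivity.
Qed.

Lemma Im_sum_n (u : nat -> C) n :
  Im (sum_n (G := C_NormedModule) u n) = sum_n (fun k => Im (u k)) n.
Proof.
  induction n as [|n IH]; [rewrite !sum_O; reflexivity|].
  rewrite !sum_Sn, <- IH; reflexivity.
Qed.

Lemma is_series_C_iff (u : nat -> C) (l : C) :
  is_series (V := C_NormedModule) u l <->
  is_series (fun n => Re (u n)) (Re l) /\ is_series (fun n => Im (u n)) (Im l).
Proof.
  unfold is_series at 1; split.
  - intros H; apply filterlim_C_iff in H; destruct H as [H1 H2]; split.
    + eapply filterlim_ext; [|exact H1]; intros n; apply Re_sum_n.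
    + eapply filterlim_ext; [|exact H2]; intros n; apply Im_sum_n.
  - intros [H1 H2]; apply filterlim_C_iff; split.
    + eapply filterlim_ext; [|exact H1]; intros n; symmetry; apply Re_sum_n.
    + eapply filterlim_ext; [|exact H2]; intros n; symmetry; apply Im_sum_n.
Qed.

Lemma Clim_seq_unique (u : nat -> C) (l : C) :
  filterlim u eventually (locally (T := C_UniformSpace) l) -> Clim_seq u = l.
Proof.
  intros H.
  exact (iota_filterlim_locally (V := C_CompleteNormedModule) (F := eventually)
    u l H).
Qed.

Lemma Cseries_unique (u : nat -> C) (l : C) :
  is_series (V := C_NormedModule) u l -> Cseries u = l.
Proof.
  intros H.
  exact (iota_filterlim_locally (V := C_CompleteNormedModule) (F := eventually)
    (sum_n (G := C_NormedModule) u) l H).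
Qed.

Lemma ex_series_C_le (u : nat -> C) (b : nat -> R) :
  (forall n, Cmod (u n) <= b n) -> ex_series b ->
  exists l, is_series (V := C_NormedModule) u l.
Proof.
  intros H Hb; apply (ex_series_le (V := C_CompleteNormedModule) u b); auto.
Qed.

Lemma im_le_Cmod (c : C) : Rabs (Im c) <= Cmod c.
Proof. eapply Rle_trans; [apply Rmax_r|apply Rmax_Cmod]. Qed.

(* The cells [f k j] of the line [2 k + j = N], indexed by [k]. *)
Definition diag {T} (zero : T) (f : nat -> nat -> T) (N k : nat) : T :=
  if (2 * k <=? N)%nat then f k (N - 2 * k)%nat else zero.

(** Both sides add the cells with [2 k + j <= M]; a new line contributes one cell to each row that
    it reaches. *)
Lemma sum_diag (f : nat -> nat -> R) M :
  sum_f_R0 (fun N => sum_f_R0 (diag 0 f N) N) M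
  = sum_f_R0 (fun k => if (2 * k <=? M)%nat then sum_f_R0 (f k) (M - 2 * k) else 0) M.
Proof.
  induction M as [|M IH]; [reflexivity|].
  rewrite tech5, IH, (tech5 _ M), (tech5 _ M).
  rewrite <- Rplus_assoc, <- plus_sum; f_equal.
  - apply sum_eq; intros k Hk; unfold diag.
    destruct (Nat.leb_spec (2 * k) M) as [H|H];
      destruct (Nat.leb_spec (2 * k) (S M)) as [H'|H']; try lia; [| |ring].
    + replace (S M - 2 * k)%nat with (S (M - 2 * k)) by lia; rewrite tech5; ring.
    + replace (S M - 2 * k)%nat with O by lia; simpl; ring.
  - unfold diag; destruct (Nat.leb_spec (2 * S M) (S M)); [lia|reflexivity].
Qed.

Lemma sum_f_R0_le_series (b : nat -> R) l n :
  (forall k, 0 <= b k) -> is_series b l -> sum_f_R0 b n <= l.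
Proof.
  intros Hb Hl; rewrite <- sum_n_Reals.
  apply (is_lim_seq_incr_compare (sum_n b)); [exact Hl|].
  intros k; rewrite sum_Sn; unfold plus; simpl; specialize (Hb (S k)); lra.
Qed.

Lemma is_lim_seq_sum_f_R0 (u : nat -> nat -> R) (l : nat -> R) K :
  (forall k, (k <= K)%nat -> is_lim_seq (u k) (l k)) ->
  is_lim_seq (fun J => sum_f_R0 (fun k => u k J) K) (sum_f_R0 l K).
Proof.
  intros H; induction K as [|K IH]; simpl; [apply H; lia|].
  apply is_lim_seq_plus'; [apply IH; intros; apply H; lia|apply H; lia].
Qed.

(** Rearrangement of a double series from rows to lines, with domination stated on the lines, the
    form in which the kernel bound comes. *)
Lemma series_diag_R (f : nat -> nat -> R) (s M : nat -> R) :
  (forall k, is_series (f k) (s k)) ->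
  (forall N, sum_f_R0 (fun k => Rabs (diag 0 f N k)) N <= M N) ->
  ex_series M ->
  exists l, is_series s l /\ is_series (fun N => sum_f_R0 (diag 0 f N) N) l.
Proof.
  intros Hs HM [m Hm].
  assert (HM0 : forall N, 0 <= M N).
  { intros N; eapply Rle_trans; [|apply HM]; apply cond_pos_sum; intros; apply Rabs_pos. }
  assert (HD : ex_series (fun N => sum_f_R0 (diag 0 f N) N)).
  { apply (ex_series_le (V := R_CompleteNormedModule) _ M); [|exists m; auto].
    intros N; eapply Rle_trans; [apply Rsum_abs|apply HM]. }
  destruct HD as [l Hl]; exists l; split; [|exact Hl].
  (* Rows [0] to [n] contain all cells of the lines [0] to [n]; their remaining cells lie on later
     lines and are controlled by the tail of [M]. *)
  assert (B : forall n, Rabs (sum_f_R0 s n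
      - sum_f_R0 (fun N => sum_f_R0 (diag 0 f N) N) n) <= m - sum_f_R0 M n).
  { intros n.
    set (A := fun k n => if (2 * k <=? n)%nat then sum_f_R0 (f k) (n - 2 * k) else 0).
    set (A' := fun k n => if (2 * k <=? n)%nat
      then sum_f_R0 (fun j => Rabs (f k j)) (n - 2 * k) else 0).
    assert (EA : sum_f_R0 (fun N => sum_f_R0 (diag 0 f N) N) n
      = sum_f_R0 (fun k => A k n) n) by apply sum_diag.
    assert (EA2 : forall p, sum_f_R0 (fun k => A' k p) p
       = sum_f_R0 (fun N => sum_f_R0 (fun k => Rabs (diag 0 f N k)) N) p).
    { intros p; unfold A'; rewrite <- (sum_diag (fun k j => Rabs (f k j))).
      apply sum_eq; intros N _; apply sum_eq; intros k _; unfold diag.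
      destruct (_ <=? _)%nat; [reflexivity|rewrite Rabs_R0; reflexivity]. }
    assert (LA : forall k, is_lim_seq (fun J => A k (n + J)%nat) (s k)).
    { intros k; apply (is_lim_seq_incr_n _ (2 * k)).
      specialize (Hs k); unfold is_series in Hs.
      apply (is_lim_seq_ext (fun J => sum_n (f k) (J + n))%nat).
      - intros J; unfold A; destruct (Nat.leb_spec (2 * k) (n + (J + 2 * k))); [|lia].
        rewrite sum_n_Reals; f_equal; lia.
      - apply (is_lim_seq_incr_n (sum_n (f k))); exact Hs. }
    (* The rows are first cut at the common level [n + J], which keeps all sums finite; [LA] then
       gives the limit in [J]. *)
    assert (T : forall J, Rabs (sum_f_R0 (fun k => A k (n + J)%nat - A k n) n)
       <= m - sum_f_R0 M n).
    { intros J.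
      apply Rle_trans with (sum_f_R0 (fun k => A' k (n + J)%nat - A' k n) n).
      - eapply Rle_trans; [apply Rsum_abs|]; apply sum_Rle; intros k _.
        induction J as [|J IH]; [rewrite Nat.add_0_r, !Rminus_diag, Rabs_R0; lra|].
        apply Rle_trans with (Rabs (A k (n + J)%nat - A k n)
          + Rabs (A k (n + S J)%nat - A k (n + J)%nat)).
        { replace (A k (n + S J)%nat - A k n) with
           ((A k (n + J)%nat - A k n) + (A k (n + S J)%nat - A k (n + J)%nat)) by ring.
          apply Rabs_triang. }
        assert (St : Rabs (A k (n + S J)%nat - A k (n + J)%nat)
          <= A' k (n + S J)%nat - A' k (n + J)%nat); [|lra].
        unfold A, A'; replace (n + S J)%nat with (S (n + J)) by lia.
        destruct (Nat.leb_spec (2 * k) (n + J)); destruct (Nat.leb_spec (2 * k) (S (n + J)));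
          try lia.
        + replace (S (n + J) - 2 * k)%nat with (S (n + J - 2 * k)) by lia.
          rewrite !tech5; replace (_ - _) with (f k (S (n + J - 2 * k))) by ring; lra.
        + replace (S (n + J) - 2 * k)%nat with O by lia; simpl; rewrite !Rminus_0_r; lra.
        + rewrite Rminus_0_r, Rabs_R0; lra.
      - rewrite minus_sum.
        apply Rle_trans with (sum_f_R0 (fun k => A' k (n + J)%nat) (n + J)
          - sum_f_R0 (fun k => A' k n) n).
        (* Including the rows [n + 1] to [n + J] only increases a sum of absolute values, and makes
           [sum_diag] applicable. *)
        + apply Rplus_le_compat_r.
          assert (P : forall k p, 0 <= A' k p).
          { intros k p; unfold A'; destruct (_ <=? _)%nat; [|lra].
            apply cond_pos_sum; intros; apply Rabs_pos. }
          assert (Q : forall p J, sum_f_R0 (fun k => A' k p) n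
            <= sum_f_R0 (fun k => A' k p) (n + J)); [|apply Q].
          clear - P; intros p J; induction J as [|J IH]; [rewrite Nat.add_0_r; lra|].
          rewrite Nat.add_succ_r, tech5; specialize (P (S (n + J)) p); lra.
        + rewrite !EA2.
          assert (I : forall J, sum_f_R0 (fun N => sum_f_R0 (fun k => Rabs (diag 0 f N k)) N) (n + J)
            - sum_f_R0 (fun N => sum_f_R0 (fun k => Rabs (diag 0 f N k)) N) n
            <= sum_f_R0 M (n + J) - sum_f_R0 M n).
          { revert HM; set (g := fun N => sum_f_R0 (fun k => Rabs (diag 0 f N k)) N).
            intros HM; assert (HM' : forall N, g N <= M N) by exact HM.
            clear - HM'; induction J as [|J IH]; [rewrite Nat.add_0_r; lra|].
            rewrite Nat.add_succ_r, !tech5; specialize (HM' (S (n + J))); lra. }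
          specialize (I J).
          pose proof (sum_f_R0_le_series M m (n + J) HM0 Hm); lra. }
    rewrite EA, <- minus_sum.
    assert (L : is_lim_seq (fun J => Rabs (sum_f_R0 (fun k => A k (n + J)%nat - A k n) n))
      (Rabs (sum_f_R0 (fun k => s k - A k n) n))).
    { apply (is_lim_seq_abs _ (sum_f_R0 (fun k => s k - A k n) n)).
      apply (is_lim_seq_sum_f_R0 (fun k J => A k (n + J)%nat - A k n) (fun k => s k - A k n)).
      intros k _; apply is_lim_seq_minus'; [apply LA|apply is_lim_seq_const]. }
    apply (is_lim_seq_le _ _ _ (Finite (m - sum_f_R0 M n)) T L).
    apply is_lim_seq_const. }
  change (is_lim_seq (sum_n s) (Finite l)).
  apply (is_lim_seq_ext (fun n => sum_f_R0 (fun N => sum_f_R0 (diag 0 f N) N) n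
    + (sum_f_R0 s n - sum_f_R0 (fun N => sum_f_R0 (diag 0 f N) N) n))).
  { intros n; rewrite sum_n_Reals; ring. }
  rewrite <- (Rplus_0_r l); apply is_lim_seq_plus'.
  - apply (is_lim_seq_ext (sum_n (fun N => sum_f_R0 (diag 0 f N) N)));
      [intros; apply sum_n_Reals|exact Hl].
  - apply is_lim_seq_abs_0.
    apply (is_lim_seq_le_le (fun _ => 0) _ (fun n => m - sum_f_R0 M n)).
    + intros n; split; [apply Rabs_pos|apply B].
    + apply is_lim_seq_const.
    + replace (Finite 0) with (Finite (m - m)) by (f_equal; ring).
      apply is_lim_seq_minus'; [apply is_lim_seq_const|].
      apply (is_lim_seq_ext (sum_n M)); [intros; apply sum_n_Reals|exact Hm].
Qed.

Lemma series_diag_C (f : nat -> nat -> C) (s D : nat -> C) (M : nat -> R) :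
  (forall k, is_series (V := C_NormedModule) (f k) (s k)) ->
  (forall N, D N = sum_n (G := C_NormedModule) (diag (RtoC 0) f N) N) ->
  (forall N, sum_f_R0 (fun k => Cmod (diag (RtoC 0) f N k)) N <= M N) ->
  ex_series M ->
  exists l, is_series (V := C_NormedModule) s l /\ is_series (V := C_NormedModule) D l.
Proof.
  intros Hs HD HM EM.
  destruct (series_diag_R (fun k j => Re (f k j)) (fun k => Re (s k)) M) as [lr [R1 R2]]; auto.
  { intros k; specialize (Hs k); apply is_series_C_iff in Hs; apply Hs. }
  { intros N; eapply Rle_trans; [|apply HM]; apply sum_Rle; intros k _.
    unfold diag; destruct (_ <=? _)%nat; [apply re_le_Cmod|].
    rewrite Cmod_0, Rabs_R0; lra. }
  destruct (series_diag_R (fun k j => Im (f k j)) (fun k => Im (s k)) M) as [li [I1 I2]]; auto.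
  { intros k; specialize (Hs k); apply is_series_C_iff in Hs; apply Hs. }
  { intros N; eapply Rle_trans; [|apply HM]; apply sum_Rle; intros k _.
    unfold diag; destruct (_ <=? _)%nat; [apply im_le_Cmod|].
    rewrite Cmod_0, Rabs_R0; lra. }
  exists (lr, li); split; apply is_series_C_iff; split; auto.
  - eapply is_series_ext; [|exact R2]; intros N.
    rewrite HD, Re_sum_n, sum_n_Reals; apply sum_eq; intros k _.
    unfold diag; destruct (_ <=? _)%nat; reflexivity.
  - eapply is_series_ext; [|exact I2]; intros N.
    rewrite HD, Im_sum_n, sum_n_Reals; apply sum_eq; intros k _.
    unfold diag; destruct (_ <=? _)%nat; reflexivity.
Qed.

(** * Complex powers of positive reals *)

Lemma Ceq (z w : C) : Re z = Re w -> Im z = Im w -> z = w.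
Proof. destruct z, w; simpl; intros; f_equal; auto. Qed.

Lemma Cexp_plus (z w : C) : Cexp (z + w) = (Cexp z * Cexp w)%C.
Proof.
  destruct z, w; unfold Cexp; apply Ceq; simpl;
    rewrite exp_plus, ?cos_plus, ?sin_plus; ring.
Qed.

Lemma Cexp_0 : Cexp 0 = RtoC 1.
Proof. unfold Cexp; apply Ceq; simpl; rewrite exp_0, ?cos_0, ?sin_0; ring. Qed.

Lemma Cexp_neq_0 (z : C) : Cexp z <> RtoC 0.
Proof.
  intros H; apply C1_nz; rewrite <- Cexp_0.
  replace (RtoC 0) with (z + - z)%C at 1 by ring; rewrite Cexp_plus, H; ring.
Qed.

Lemma Crpow_plus x a b : Crpow x (a + b) = (Crpow x a * Crpow x b)%C.
Proof. unfold Crpow; rewrite <- Cexp_plus; f_equal; ring. Qed.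

Lemma Crpow_0 x : Crpow x 0 = RtoC 1.
Proof. unfold Crpow; rewrite Cmult_0_l; apply Cexp_0. Qed.

Lemma Crpow_neq_0 x a : Crpow x a <> RtoC 0.
Proof. apply Cexp_neq_0. Qed.

Lemma Crpow_opp x a : Crpow x (- a) = (/ Crpow x a)%C.
Proof.
  assert (H : (Crpow x (- a) * Crpow x a)%C = RtoC 1).
  { rewrite <- Crpow_plus, Cplus_comm, Cplus_opp_r; apply Crpow_0. }
  pose proof (Crpow_neq_0 x a) as N.
  replace (Crpow x (- a)) with (Crpow x (- a) * Crpow x a * / Crpow x a)%C
    by (field; exact N).
  rewrite H; ring.
Qed.

Lemma Crpow_mult x y a : 0 < x -> 0 < y ->
  Crpow (x * y) a = (Crpow x a * Crpow y a)%C.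
Proof.
  intros; unfold Crpow; rewrite <- Cexp_plus, ln_mult, RtoC_plus by auto.
  f_equal; ring.
Qed.

Lemma Crpow_inv x a : 0 < x -> Crpow (/ x) a = Crpow x (- a).
Proof. intros; unfold Crpow; rewrite ln_Rinv, RtoC_opp by auto; f_equal; ring. Qed.

Lemma Crpow_div x y a : 0 < x -> 0 < y ->
  Crpow (x / y) a = (Crpow x a / Crpow y a)%C.
Proof.
  intros; unfold Rdiv, Cdiv.
  rewrite Crpow_mult, Crpow_inv, Crpow_opp by auto using Rinv_0_lt_compat.
  reflexivity.
Qed.

Lemma Crpow_nat x n : 0 < x -> Crpow x (RtoC (INR n)) = RtoC (x ^ n).
Proof.
  intros Hx; induction n as [|n IH].
  - simpl; apply Crpow_0.
  - rewrite S_INR, RtoC_plus, Crpow_plus, IH; simpl; rewrite RtoC_mult, Cmult_comm.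
    f_equal; unfold Crpow, Cexp; apply Ceq; simpl;
      rewrite ?Rmult_0_l, ?Rmult_0_r, ?Rmult_1_l, ?Rminus_0_r, ?Rplus_0_r.
    + rewrite exp_ln, cos_0 by auto; ring.
    + rewrite sin_0; ring.
Qed.

Lemma Crpow_half_nat x n : 0 < x ->
  Crpow (x ^ 2) (RtoC (INR n) / 2) = RtoC (x ^ n).
Proof.
  intros Hx; simpl; rewrite Rmult_1_r, Crpow_mult, <- Crpow_plus by auto.
  rewrite <- Crpow_nat by auto; f_equal; field.
Qed.

(** * The binomial series with complex exponent *)

Lemma rpoch_ratio_lim A : 0 < A ->
  is_lim_seq (fun n => Rabs (rpoch A (S n) / INR (fact (S n))
                             / (rpoch A n / INR (fact n)))) 1.
Proof.
  intros HA.
  apply (is_lim_seq_ext (fun n => 1 + (A - 1) * / INR (S n))).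
  - intros n; pose proof (rpoch_pos A n HA).
    assert (0 < A + INR n) by (pose proof (pos_INR n); lra).
    assert (0 < INR (S n)) by (apply lt_0_INR; lia).
    rewrite Rabs_right.
    + rewrite fact_simpl, mult_INR; simpl rpoch.
      replace (A + INR n) with (INR (S n) + (A - 1)) by (rewrite S_INR; ring).
      field; repeat split; try lra; apply INR_fact_neq_0.
    + apply Rle_ge, Rmult_le_pos; [apply Rmult_le_pos|].
      * left; apply rpoch_pos; auto.
      * left; apply Rinv_0_lt_compat, INR_fact_lt_0.
      * left; apply Rinv_0_lt_compat, Rmult_lt_0_compat; auto.
        apply Rinv_0_lt_compat, INR_fact_lt_0.
  - replace (Finite 1) with (Finite (1 + (A - 1) * 0)) by (f_equal; ring).
    apply is_lim_seq_plus'; [apply is_lim_seq_const|].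
    apply is_lim_seq_mult'; [apply is_lim_seq_const|].
    apply (is_lim_seq_inv _ p_infty); [|discriminate].
    apply (is_lim_seq_incr_1 INR), is_lim_seq_INR.
Qed.

Lemma CV_radius_rpoch A : 0 < A ->
  CV_radius (fun n => rpoch A n / INR (fact n)) = Finite 1.
Proof.
  intros HA.
  rewrite (CV_radius_finite_DAlembert _ 1); [f_equal; apply Rinv_1| |lra|].
  - intros n; apply Rgt_not_eq, Rmult_lt_0_compat; [apply rpoch_pos; auto|].
    apply Rinv_0_lt_compat, INR_fact_lt_0.
  - apply rpoch_ratio_lim; auto.
Qed.

Lemma ex_series_rpoch A y : 0 < A -> 0 <= y < 1 ->
  ex_series (fun n => rpoch A n / INR (fact n) * y ^ n).
Proof.
  intros HA Hy.
  apply ex_pseries_R, CV_radius_inside.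
  rewrite CV_radius_rpoch by auto; simpl; rewrite Rabs_right; lra.
Qed.

(** The shift by 1 keeps the real base positive even at [z = 0], as the ratio test for the
    dominating series requires. *)
Lemma Cmod_poch_le z n : Cmod (Cpoch z n) <= rpoch (Cmod z + 1) n.
Proof.
  induction n as [|n IH]; simpl; [rewrite Cmod_1; lra|].
  rewrite Cmod_mult; apply Rmult_le_compat; try apply Cmod_ge_0; auto.
  eapply Rle_trans; [apply Cmod_triangle|].
  rewrite Cmod_R, Rabs_right by (apply Rle_ge, pos_INR); lra.
Qed.

(** Taylor coefficients of [(1-y)^(-z)] at 0. *)
Definition bcoef (z : C) (n : nat) : C := (Cpoch z n / RtoC (INR (fact n)))%C.

Lemma Cmod_bcoef_le z n : Cmod (bcoef z n) <= rpoch (Cmod z + 1) n / INR (fact n).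
Proof.
  unfold bcoef, Cdiv.
  assert (RtoC (INR (fact n)) <> 0) by (intros E; apply RtoC_inj in E; revert E; apply INR_fact_neq_0).
  rewrite Cmod_mult, Cmod_inv, Cmod_R, Rabs_right by (auto; apply Rle_ge, pos_INR).
  apply Rmult_le_compat_r; [|apply Cmod_poch_le].
  left; apply Rinv_0_lt_compat, INR_fact_lt_0.
Qed.

Lemma bcoef_S z n :
  (RtoC (INR (S n)) * bcoef z (S n) = (z + RtoC (INR n)) * bcoef z n)%C.
Proof.
  unfold bcoef; rewrite fact_simpl, mult_INR, RtoC_mult; simpl Cpoch.
  assert (RtoC (INR (S n)) <> 0).
  { intros E; apply RtoC_inj in E; revert E; apply not_0_INR; lia. }
  assert (RtoC (INR (fact n)) <> 0) by (intros E; apply RtoC_inj in E; revert E; apply INR_fact_neq_0).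
  field; auto.
Qed.

Lemma CV_radius_bcoef z y : Rabs y < 1 ->
  Rbar_lt (Rabs y) (CV_radius (fun n => Re (bcoef z n))) /\
  Rbar_lt (Rabs y) (CV_radius (fun n => Im (bcoef z n))).
Proof.
  intros Hy.
  assert (H : forall a : nat -> R, (forall n, Rabs (a n) <= Cmod (bcoef z n)) ->
    Rbar_lt (Rabs y) (CV_radius a)).
  (* A radius strictly between [|y|] and 1, where the dominating series still converges. *)
  { intros a Ha; set (r := (Rabs y + 1) / 2); pose proof (Rabs_pos y).
    apply Rbar_lt_le_trans with (Finite r); [simpl; unfold r; lra|].
    apply (proj1 (Lub_Rbar_correct (CV_disk a))).
    apply (ex_series_le (V := R_CompleteNormedModule) _
      (fun n => rpoch (Cmod z + 1) n / INR (fact n) * r ^ n)).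
    - intros n; unfold norm; simpl; unfold abs; simpl.
      rewrite Rabs_Rabsolu, Rabs_mult, <- RPow_abs.
      rewrite (Rabs_right r) by (unfold r; lra).
      apply Rmult_le_compat_r; [apply pow_le; unfold r; lra|].
      eapply Rle_trans; [apply Ha|apply Cmod_bcoef_le].
    - apply ex_series_rpoch; [pose proof (Cmod_ge_0 z); lra|unfold r; lra]. }
  split; apply H; intros n; [apply re_le_Cmod|apply im_le_Cmod].
Qed.

(** The equation [(1-y) f' = z f] in real and imaginary parts, since power series are differentiated
    here over the reals. *)
Lemma binomial_series_ode (z : C) y : Rabs y < 1 ->
  let fr := PSeries (fun n => Re (bcoef z n)) in
  let fi := PSeries (fun n => Im (bcoef z n)) in
  exists dr di : R, is_derive fr y dr /\ is_derive fi y di /\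
   (1 - y) * dr = Re z * fr y - Im z * fi y /\
   (1 - y) * di = Re z * fi y + Im z * fr y.
Proof.
  intros Hy fr fi.
  destruct (CV_radius_bcoef z y Hy) as [Cr Ci].
  set (cr := fun n => Re (bcoef z n)) in *; set (ci := fun n => Im (bcoef z n)) in *.
  exists (PSeries (PS_derive cr) y), (PSeries (PS_derive ci) y).
  pose proof (CV_radius_inside _ _ Cr) as Er; pose proof (CV_radius_inside _ _ Ci) as Ei.
  assert (Dr : ex_pseries (PS_derive cr) y)
    by (apply CV_radius_inside; rewrite CV_radius_derive; auto).
  assert (Di : ex_pseries (PS_derive ci) y)
    by (apply CV_radius_inside; rewrite CV_radius_derive; auto).
  split; [apply is_derive_PSeries; auto|]; split; [apply is_derive_PSeries; auto|].
  assert (Rec : forall n, INR (S n) * cr (S n) = (Re z + INR n) * cr n - Im z * ci n /\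
     INR (S n) * ci (S n) = (Re z + INR n) * ci n + Im z * cr n).
  { intros n; pose proof (bcoef_S z n) as E; unfold cr, ci; split.
    - apply (f_equal Re) in E; rewrite re_scal_l in E; rewrite E; unfold Re, Im; simpl; ring.
    - apply (f_equal Im) in E; rewrite im_scal_l in E; rewrite E; unfold Re, Im; simpl; ring. }
  assert (Er1 : forall a : nat -> R, ex_pseries (PS_derive a) y -> ex_pseries (PS_incr_1 (PS_derive a)) y).
  { intros a Ha; apply ex_pseries_incr_1; exact Ha. }
  split.
  (* In the form [f' = z f + y f'] the equation is [bcoef_S] read coefficientwise: the shifted
     series [y f'] supplies the term [n c_n]. *)
  - assert (E : PSeries (PS_derive cr) y = Re z * fr y - Im z * fi y
      + y * PSeries (PS_derive cr) y); [|lra].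
    unfold fr, fi; rewrite <- PSeries_incr_1, <- !PSeries_scal.
    rewrite <- PSeries_minus, <- PSeries_plus;
      [ |apply ex_pseries_minus; apply ex_pseries_scal; auto; apply Rmult_comm| apply Er1; auto
        |apply ex_pseries_scal; auto; apply Rmult_comm|apply ex_pseries_scal; auto; apply Rmult_comm].
    apply PSeries_ext; intros n; destruct (Rec n) as [R1 _].
    unfold PS_derive at 1; rewrite R1.
    unfold PS_plus, PS_minus, PS_scal, PS_incr_1, PS_derive.
    unfold PS_plus, PS_opp, plus, opp, scal; simpl; unfold mult; simpl.
    destruct n as [|n]; [unfold zero; simpl; ring|].
    change (match n with O => 1 | S _ => INR n + 1 end) with (INR (S n)).
    ring.
  - assert (E : PSeries (PS_derive ci) y = Re z * fi y + Im z * fr y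
      + y * PSeries (PS_derive ci) y); [|lra].
    unfold fr, fi; rewrite <- PSeries_incr_1, <- !PSeries_scal.
    rewrite <- !PSeries_plus;
      [ |apply ex_pseries_plus; apply ex_pseries_scal; auto; apply Rmult_comm| apply Er1; auto
        |apply ex_pseries_scal; auto; apply Rmult_comm|apply ex_pseries_scal; auto; apply Rmult_comm].
    apply PSeries_ext; intros n; destruct (Rec n) as [_ R1].
    unfold PS_derive at 1; rewrite R1.
    unfold PS_plus, PS_minus, PS_scal, PS_incr_1, PS_derive.
    unfold plus, opp, scal; simpl; unfold mult; simpl.
    destruct n as [|n]; [unfold zero; simpl; ring|].
    change (match n with O => 1 | S _ => INR n + 1 end) with (INR (S n)).
    ring.
Qed.

Lemma binomial_series (z : C) y : Rabs y < 1 ->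
  is_series (V := C_NormedModule) (fun n => bcoef z n * RtoC (y ^ n))%C
    (Crpow (1 - y) (- z)).
Proof.
  intros Hy.
  set (fr := PSeries (fun n => Re (bcoef z n))).
  set (fi := PSeries (fun n => Im (bcoef z n))).
  set (a := Re z); set (b := Im z).
  (* [U] and [V] are the real and imaginary parts of [(1-y)^z f(y)], which has derivative 0 and
     value 1 at 0. *)
  set (U := fun y => exp (a * ln (1 - y)) * (cos (b * ln (1 - y)) * fr y - sin (b * ln (1 - y)) * fi y)).
  set (V := fun y => exp (a * ln (1 - y)) * (sin (b * ln (1 - y)) * fr y + cos (b * ln (1 - y)) * fi y)).
  assert (D : forall t : R, Rabs t < 1 -> is_derive U t 0 /\ is_derive V t 0).
  { intros t Ht; destruct (binomial_series_ode z t Ht) as [dr [di [Dr [Di [Er Ei]]]]].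
    fold fr in Dr, Er, Ei; fold fi in Di, Er, Ei; fold a b in Er, Ei.
    assert (Ht' : 0 < 1 - t) by (apply Rabs_def2 in Ht; lra).
    assert (Hr : dr = (a * fr t - b * fi t) / (1 - t)) by (rewrite <- Er; field; lra).
    assert (Hi : di = (a * fi t + b * fr t) / (1 - t)) by (rewrite <- Ei; field; lra).
    split; unfold U, V; auto_derive.
    - repeat split; auto; [exists dr|exists di]; auto.
    - rewrite_Derive Dr; rewrite_Derive Di; rewrite Hr, Hi.
      field; lra.
    - repeat split; auto; [exists dr|exists di]; auto.
    - rewrite_Derive Dr; rewrite_Derive Di; rewrite Hr, Hi.
      field; lra. }
  assert (Cst : forall W : R -> R, (forall t : R, Rabs t < 1 -> is_derive W t 0) -> W y = W 0).
  { intros W HW; apply Rabs_def2 in Hy.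
    destruct (Rtotal_order 0 y) as [L|[L|L]]; [symmetry|subst; reflexivity|];
      apply @eq_is_derive; auto; intros t Ht; apply HW, Rabs_def1; lra. }
  assert (F0 : fr 0 = 1 /\ fi 0 = 0).
  { unfold fr, fi; rewrite !PSeries_0; unfold bcoef; simpl; split; field. }
  destruct F0 as [F0r F0i].
  assert (HU : U y = 1).
  { rewrite (Cst U) by (intros; apply D; auto); unfold U.
    rewrite F0r, F0i, Rminus_0_r, ln_1, !Rmult_0_r, exp_0, ?cos_0, ?sin_0; ring. }
  assert (HV : V y = 0).
  { rewrite (Cst V) by (intros; apply D; auto); unfold V.
    rewrite F0r, F0i, Rminus_0_r, ln_1, !Rmult_0_r, exp_0, ?cos_0, ?sin_0; ring. }
  destruct (CV_radius_bcoef z y Hy) as [Cr Ci].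
  pose proof (exp_pos (a * ln (1 - y))) as Hexp.
  pose proof (sin2_cos2 (b * ln (1 - y))) as SC; unfold Rsqr in SC.
  assert (EF : fr y = Re (Crpow (1 - y) (- z)) /\ fi y = Im (Crpow (1 - y) (- z))).
  { unfold Crpow, Cexp; simpl; fold a b.
    replace (- Im z) with (- b) by reflexivity.
    change (fst z) with a; change (snd z) with b.
    rewrite !Rmult_0_r, Rminus_0_r, Rplus_0_l.
    rewrite ?Ropp_mult_distr_l_reverse, cos_neg, sin_neg, exp_Ropp.
    unfold U in HU; unfold V in HV.
    set (e := exp (a * ln (1 - y))) in *.
    set (c := cos (b * ln (1 - y))) in *; set (s := sin (b * ln (1 - y))) in *.
    (* Multiplying [U + i V = 1] by the conjugate phase isolates [fr] and [fi]. *)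
    assert (R1 : e * fr y = c).
    { transitivity (e * (c * fr y - s * fi y) * c + e * (s * fr y + c * fi y) * s).
      - transitivity (e * fr y * (s * s + c * c)); [rewrite SC|]; ring.
      - rewrite HU, HV; ring. }
    assert (R2 : e * fi y = - s).
    { transitivity (- (e * (c * fr y - s * fi y)) * s + e * (s * fr y + c * fi y) * c).
      - transitivity (e * fi y * (s * s + c * c)); [rewrite SC|]; ring.
      - rewrite HU, HV; ring. }
    split; apply Rmult_eq_reg_l with e; try lra; [rewrite R1|rewrite R2]; field; lra. }
  destruct EF as [EFr EFi].
  apply is_series_C_iff; split.
  - rewrite <- EFr.
    apply (is_series_ext (fun n => Re (bcoef z n) * y ^ n)).
    + intros n; rewrite re_scal_r; reflexivity.
    + apply is_pseries_R, PSeries_correct, CV_radius_inside, Cr.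
  - rewrite <- EFi.
    apply (is_series_ext (fun n => Im (bcoef z n) * y ^ n)).
    + intros n; rewrite im_scal_r; reflexivity.
    + apply is_pseries_R, PSeries_correct, CV_radius_inside, Ci.
Qed.

(** * The reciprocal Gamma function *)

Definition gauss (z : C) (N : nat) : C :=
  (Cpoch z (S N) / (RtoC (INR (fact N)) * Crpow (INR N) z))%C.

(* For [h = 1/(N+1)] this estimates the ratio of consecutive terms of Gauss'
   product. *)
Lemma gauss_factor_bound (z : C) : exists B, 0 <= B /\ forall h, 0 <= h <= / 2 ->
  Cmod ((1 + z * RtoC h) * Crpow (1 - h) z - 1) <= B * h ^ 2.
Proof.
  set (w := (- z)%C).
  assert (Hw : 0 < Cmod w + 1) by (pose proof (Cmod_ge_0 w); lra).
  set (b := fun n => rpoch (Cmod w + 1) n / INR (fact n)).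
  assert (Hb : forall n, 0 <= b n).
  { intros n; left; apply Rmult_lt_0_compat; [apply rpoch_pos; auto|].
    apply Rinv_0_lt_compat, INR_fact_lt_0. }
  assert (Eb : ex_series (fun n => b n * (/ 2) ^ n))
    by (apply ex_series_rpoch; lra).
  destruct Eb as [S HS].
  (* For [h <= 1/2] one has [h^(2+k) <= 4 h^2 (1/2)^(2+k)], so the binomial series beyond its linear
     term is at most [4 h^2 S]. *)
  set (T := 4 * S).
  assert (Q : forall h, 0 <= h <= / 2 ->
    Cmod (Crpow (1 - h) z - (1 - z * RtoC h)) <= T * h ^ 2).
  { intros h Hh.
    assert (Hs : is_series (V := C_NormedModule)
       (fun n => bcoef w n * RtoC (h ^ n))%C (Crpow (1 - h) z)).
    { replace z with (- w)%C by (unfold w; ring).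
      apply binomial_series; rewrite Rabs_right; lra. }
    assert (P : forall n, Cmod (sum_n (G := C_NormedModule)
       (fun n => bcoef w n * RtoC (h ^ n))%C (2 + n) - (1 - z * RtoC h)) <= T * h ^ 2).
    { intros n.
      assert (P' : Cmod (sum_n (G := C_NormedModule)
       (fun n => bcoef w n * RtoC (h ^ n))%C (2 + n) - (1 - z * RtoC h))
       <= 4 * h ^ 2 * sum_f_R0 (fun n => b n * (/ 2) ^ n) (2 + n)).
      { assert (G : forall k, Cmod (bcoef w (2 + k) * RtoC (h ^ (2 + k)))
          <= 4 * h ^ 2 * (b (2 + k)%nat * (/ 2) ^ (2 + k))).
        { intros k; rewrite Cmod_mult, Cmod_R, Rabs_right by (apply Rle_ge, pow_le; lra).
          replace (4 * h ^ 2 * (b (2 + k)%nat * (/ 2) ^ (2 + k))) with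
            (b (2 + k)%nat * (h ^ 2 * (/ 2) ^ k)) by (simpl; field).
          apply Rmult_le_compat; try apply Cmod_ge_0; [apply pow_le; lra| |].
          - apply Cmod_bcoef_le.
          - rewrite pow_add; apply Rmult_le_compat_l; [apply pow2_ge_0|].
            apply pow_incr; lra. }
        induction n as [|n IH].
        - replace (2 + 0)%nat with 2%nat by reflexivity.
          rewrite !sum_Sn, sum_O.
          replace (plus _ _ - _)%C with (bcoef w 2 * RtoC (h ^ 2))%C.
          2:{ unfold plus; simpl; unfold bcoef, w; simpl Cpoch; simpl fact; simpl INR.
              rewrite !RtoC_mult, RtoC_plus. field. }
          eapply Rle_trans; [apply (G O)|].
          apply Rmult_le_compat_l; [pose proof (pow2_ge_0 h); lra|].
          simpl sum_f_R0.
          pose proof (Hb 0%nat); pose proof (Hb 1%nat).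
          replace (2 + 0)%nat with 2%nat by reflexivity.
          simpl pow; lra.
        - replace (2 + Datatypes.S n)%nat with (Datatypes.S (2 + n)) by lia.
          rewrite sum_Sn, tech5.
          replace (plus _ _ - _)%C with
            ((sum_n (G := C_NormedModule) (fun n => bcoef w n * RtoC (h ^ n))%C (2 + n)
              - (1 - z * RtoC h)) + bcoef w (Datatypes.S (2 + n)) * RtoC (h ^ Datatypes.S (2 + n)))%C
            by (unfold plus; simpl; ring).
          eapply Rle_trans; [apply Cmod_triangle|].
          rewrite Rmult_plus_distr_l; apply Rplus_le_compat; [exact IH|].
          apply (G (Datatypes.S n)). }
      eapply Rle_trans; [exact P'|].
      unfold T; rewrite (Rmult_assoc 4 S), (Rmult_comm S), <- Rmult_assoc.
      apply Rmult_le_compat_l; [pose proof (pow2_ge_0 h); lra|].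
      apply sum_f_R0_le_series; auto.
      intros k; apply Rmult_le_pos; auto; apply pow_le; lra. }
    assert (L : filterlim (fun n => (sum_n (G := C_NormedModule)
       (fun n => bcoef w n * RtoC (h ^ n))%C (2 + n) - (1 - z * RtoC h))%C) eventually
       (locally (T := C_UniformSpace) (Crpow (1 - h) z - (1 - z * RtoC h))%C)).
    { apply filterlim_C_iff in Hs; destruct Hs as [Hr Hi].
      apply filterlim_C_iff; split.
      - eapply is_lim_seq_ext; [|apply is_lim_seq_minus'; 
          [apply (is_lim_seq_incr_n _ 2) in Hr; exact Hr|apply (is_lim_seq_const (Re (1 - z * RtoC h)))]].
        intros n; simpl; rewrite Nat.add_comm; reflexivity.
      - eapply is_lim_seq_ext; [|apply is_lim_seq_minus'; 
          [apply (is_lim_seq_incr_n _ 2) in Hi; exact Hi|apply (is_lim_seq_const (Im (1 - z * RtoC h)))]].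
        intros n; simpl; rewrite Nat.add_comm; reflexivity. }
    assert (L2 : is_lim_seq (fun n => Cmod (sum_n (G := C_NormedModule)
       (fun n => bcoef w n * RtoC (h ^ n))%C (2 + n) - (1 - z * RtoC h))%C)
       (Cmod (Crpow (1 - h) z - (1 - z * RtoC h)))).
    { apply (filterlim_comp _ _ _ _ (fun c : C_NormedModule => norm c) _ _ _ L).
      apply (filterlim_norm (V := C_NormedModule)). }
    apply (is_lim_seq_le _ _ _ (Finite (T * h ^ 2)) P L2), is_lim_seq_const. }
  assert (S0 : 0 <= S).
  { eapply Rle_trans; [|apply (sum_f_R0_le_series (fun n => b n * (/ 2) ^ n) S O); auto].
    - simpl; pose proof (Hb O); lra.
    - intros k; apply Rmult_le_pos; auto; apply pow_le; lra. }
  (* The first summand bounds the remainder times [1 + z h]; the second comes from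
     [(1 + z h)(1 - z h) = 1 - z^2 h^2]. *)
  exists ((1 + Cmod z) * T + Cmod z * Cmod z); pose proof (Cmod_ge_0 z) as Hz.
  split; [unfold T; nra|].
  intros h Hh; specialize (Q h Hh).
  replace ((1 + z * RtoC h) * Crpow (1 - h) z - 1)%C with
    ((1 + z * RtoC h) * (Crpow (1 - h) z - (1 - z * RtoC h)) + - (z * z * RtoC (h ^ 2)))%C
    by (rewrite RtoC_pow; ring).
  eapply Rle_trans; [apply Cmod_triangle|].
  rewrite Cmod_opp, !Cmod_mult, (Cmod_R (h ^ 2)), (Rabs_right (h ^ 2)) by apply Rle_ge, pow2_ge_0.
  rewrite Rmult_plus_distr_r; apply Rplus_le_compat; [|lra].
  rewrite Rmult_assoc; apply Rmult_le_compat; auto using Cmod_ge_0.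
  eapply Rle_trans; [apply Cmod_triangle|].
  rewrite Cmod_1, Cmod_mult, Cmod_R, Rabs_right by lra; nra.
Qed.

Lemma RtoC_neq_0 x : x <> 0 -> RtoC x <> RtoC 0.
Proof. intros H E; apply RtoC_inj in E; auto. Qed.

Lemma RtoC_fact_neq_0 n : RtoC (INR (fact n)) <> RtoC 0.
Proof. apply RtoC_neq_0, INR_fact_neq_0. Qed.

Lemma gauss_S z N : (0 < N)%nat ->
  gauss z (S N) = (gauss z N * ((1 + z * RtoC (/ INR (S N)))
                   * Crpow (1 - / INR (S N)) z))%C.
Proof.
  intros HN; assert (H1 : 0 < INR N) by (apply lt_0_INR; auto).
  assert (H2 : 0 < INR (S N)) by (apply lt_0_INR; lia).
  assert (N2 : RtoC (INR (S N)) <> 0) by (apply RtoC_neq_0; lra).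
  replace (1 - / INR (S N)) with (INR N / INR (S N))
    by (rewrite S_INR in *; field; lra).
  rewrite Crpow_div by auto; unfold gauss.
  rewrite fact_simpl, mult_INR, RtoC_mult, RtoC_inv by lra.
  change (Cpoch z (S (S N))) with (Cpoch z (S N) * (z + RtoC (INR (S N))))%C.
  pose proof (Crpow_neq_0 (INR N) z); pose proof (Crpow_neq_0 (INR (S N)) z).
  pose proof (RtoC_fact_neq_0 N).
  field; auto.
Qed.

Lemma is_series_telescope_inv :
  is_series (fun n => / INR (S n) - / INR (S (S n))) 1.
Proof.
  change (is_lim_seq (sum_n (fun n => / INR (S n) - / INR (S (S n)))) (Finite 1)).
  apply (is_lim_seq_ext (fun n => 1 - / INR (S (S n)))).
  - intros n; induction n as [|n IH]; [rewrite sum_O; simpl; lra|].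
    rewrite sum_Sn, <- IH; unfold plus; simpl AbelianMonoid.sort.
    change (1 - / INR (S (S (S n))) =
      1 - / INR (S (S n)) + (/ INR (S (S n)) - / INR (S (S (S n))))); ring.
  - replace (Finite 1) with (Finite (1 - 0)) by (f_equal; ring).
    apply is_lim_seq_minus'; [apply is_lim_seq_const|].
    apply (is_lim_seq_inv _ p_infty); [|discriminate].
    pose proof is_lim_seq_INR as H; apply (is_lim_seq_incr_n INR 2 p_infty) in H.
    apply (is_lim_seq_ext (fun n => INR (n + 2))); [|exact H].
    intros n; rewrite Nat.add_comm; reflexivity.
Qed.

Lemma inv_sqr_le_telescope n : (/ INR (S (S n))) ^ 2 <= / INR (S n) - / INR (S (S n)).
Proof.
  rewrite !S_INR; pose proof (pos_INR n).
  set (x := INR n) in *.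
  replace (/ (x + 1) - / (x + 1 + 1)) with (/ ((x + 1) * (x + 1 + 1))) by (field; lra).
  replace ((/ (x + 1 + 1)) ^ 2) with (/ ((x + 1 + 1) * (x + 1 + 1))) by (field; lra).
  apply Rinv_le_contravar; nra.
Qed.

(** Consecutive ratios are [1 + O(1/N^2)]: this first bounds the sequence, and then makes its
    increments summable by comparison with a telescoping series. *)
Lemma gauss_cvg z : exists l, filterlim (gauss z) eventually (locally (T := C_UniformSpace) l).
Proof.
  destruct (gauss_factor_bound z) as [B [HB HF]].
  (* The shift avoids [N = 0], where the base of the power is 0. *)
  set (u := fun n => gauss z (S n)).
  assert (F : forall n, Cmod ((1 + z * RtoC (/ INR (S (S n))))
       * Crpow (1 - / INR (S (S n))) z - 1) <= B * (/ INR (S n) - / INR (S (S n)))).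
  { intros n; eapply Rle_trans; [apply HF|].
    - rewrite !S_INR; pose proof (pos_INR n); split.
      + left; apply Rinv_0_lt_compat; lra.
      + apply Rinv_le_contravar; lra.
    - apply Rmult_le_compat_l; auto using inv_sqr_le_telescope. }
  assert (D : forall n, Cmod (u (S n) - u n) <= Cmod (u n) * (B * (/ INR (S n) - / INR (S (S n))))).
  { intros n; unfold u; rewrite (gauss_S z (S n)) by lia.
    match goal with |- Cmod (?a * ?b - ?a) <= _ =>
      replace (a * b - a)%C with (a * (b - 1))%C by ring end.
    rewrite Cmod_mult; apply Rmult_le_compat_l; [apply Cmod_ge_0|apply F]. }
  (* Discrete Gronwall estimate: [1 + d <= exp d], and the exponents telescope. *)
  assert (Bd : forall n, Cmod (u n) <= Cmod (u O) * exp (B * (1 - / INR (S n)))).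
  { induction n as [|n IH].
    - simpl; replace (1 - / 1) with 0 by field; rewrite Rmult_0_r, exp_0; lra.
    - set (d := B * (/ INR (S n) - / INR (S (S n)))) in *.
      replace (u (S n)) with (u n + (u (S n) - u n))%C by ring.
      eapply Rle_trans; [apply Cmod_triangle|].
      apply Rle_trans with (Cmod (u n) * (1 + d)).
      { specialize (D n); fold d in D; lra. }
      replace (B * (1 - / INR (S (S n)))) with (B * (1 - / INR (S n)) + d)
        by (unfold d; ring).
      rewrite exp_plus, <- Rmult_assoc; apply Rmult_le_compat; auto using Cmod_ge_0.
      + pose proof (Rle_trans _ _ _ (Cmod_ge_0 _) (F n)); unfold d; lra.
      + apply exp_ineq1_le. }
  set (G := Cmod (u O) * exp B).
  assert (Bd2 : forall n, Cmod (u n) <= G).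
  { intros n; eapply Rle_trans; [apply Bd|]; apply Rmult_le_compat_l; [apply Cmod_ge_0|].
    assert (0 < / INR (S n)) by (apply Rinv_0_lt_compat, lt_0_INR; lia).
    destruct (Rle_lt_or_eq_dec _ _ HB) as [L|L].
    - left; apply exp_increasing; nra.
    - right; rewrite <- L, Rmult_0_l; reflexivity. }
  destruct (ex_series_C_le (fun n => u (S n) - u n)%C
    (fun n => G * B * (/ INR (S n) - / INR (S (S n))))) as [l Hl].
  { intros n; eapply Rle_trans; [apply D|].
    rewrite (Rmult_assoc G); apply Rmult_le_compat_r; auto.
    apply (Rle_trans _ _ _ (Cmod_ge_0 _) (F n)). }
  { apply (ex_series_scal (V := R_NormedModule) (G * B)); exists 1; apply is_series_telescope_inv. }
  exists (l + u O)%C.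
  assert (E : forall n, sum_n (G := C_NormedModule) (fun n => u (S n) - u n)%C n
    = (u (S n) - u O)%C).
  { induction n as [|n IH]; [rewrite sum_O; reflexivity|].
    rewrite sum_Sn, IH; unfold plus; simpl; ring. }
  apply filterlim_C_iff in Hl; destruct Hl as [Hr Hi].
  apply filterlim_C_iff; split; apply (is_lim_seq_incr_n _ 2).
  - apply (is_lim_seq_ext (fun n => Re (sum_n (G := C_NormedModule)
      (fun n => u (S n) - u n)%C n) + Re (u O))).
    + intros n; rewrite E, Nat.add_comm; unfold u, Re; simpl; ring.
    + apply is_lim_seq_plus'; [exact Hr|apply is_lim_seq_const].
  - apply (is_lim_seq_ext (fun n => Im (sum_n (G := C_NormedModule)
      (fun n => u (S n) - u n)%C n) + Im (u O))).
    + intros n; rewrite E, Nat.add_comm; unfold u, Im; simpl; ring.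
    + apply is_lim_seq_plus'; [exact Hi|apply is_lim_seq_const].
Qed.

Lemma rgamma_lim z : filterlim (gauss z) eventually (locally (T := C_UniformSpace) (rgamma z)).
Proof.
  destruct (gauss_cvg z) as [l Hl].
  replace (rgamma z) with l; auto.
  symmetry; apply Clim_seq_unique, Hl.
Qed.

Lemma filterlim_C_mult (u v : nat -> C) (a b : C) :
  filterlim u eventually (locally (T := C_UniformSpace) a) ->
  filterlim v eventually (locally (T := C_UniformSpace) b) ->
  filterlim (fun n => u n * v n)%C eventually (locally (T := C_UniformSpace) (a * b)%C).
Proof.
  intros Hu Hv; apply filterlim_C_iff in Hu; apply filterlim_C_iff in Hv.
  destruct Hu as [ur ui]; destruct Hv as [vr vi].
  apply filterlim_C_iff; split; simpl.
  - apply is_lim_seq_minus'; apply is_lim_seq_mult'; auto.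
  - apply is_lim_seq_plus'; apply is_lim_seq_mult'; auto.
Qed.

Lemma Cpoch_add z j k : Cpoch z (j + k) = (Cpoch z j * Cpoch (z + RtoC (INR j)) k)%C.
Proof.
  induction k as [|k IH]; [rewrite Nat.add_0_r; simpl; ring|].
  rewrite Nat.add_succ_r; simpl; rewrite IH, plus_INR, RtoC_plus; ring.
Qed.

Lemma filterlim_C_const (c : C) :
  filterlim (fun _ : nat => c) eventually (locally (T := C_UniformSpace) c).
Proof. apply filterlim_C_iff; split; apply is_lim_seq_const. Qed.

Lemma is_lim_seq_inv_INR : is_lim_seq (fun n => / INR n) 0.
Proof.
  apply (is_lim_seq_inv _ p_infty); [|discriminate]; apply is_lim_seq_INR.
Qed.

(** Termwise, [z * gauss (z + 1) n] is [gauss z n] times [(z + n + 1) / n], a factor tending to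
    1. *)
Lemma rgamma_step z : rgamma z = (z * rgamma (z + 1))%C.
Proof.
  rewrite <- (Clim_seq_unique (fun n => z * gauss (z + 1) n)%C (z * rgamma (z + 1))%C).
  2:{ apply (filterlim_C_mult (fun _ => z)); [apply filterlim_C_const|apply rgamma_lim]. }
  symmetry; apply Clim_seq_unique.
  apply (filterlim_ext_loc (fun n => gauss z n * (1 + (z + 1) * RtoC (/ INR n)))%C).
  - exists 1%nat; intros n Hn.
    assert (H1 : 0 < INR n) by (apply lt_0_INR; lia).
    assert (N1 : RtoC (INR n) <> 0) by (apply RtoC_neq_0; lra).
    unfold gauss.
    replace (z * (Cpoch (z + 1) (S n) / (RtoC (INR (fact n)) * Crpow (INR n) (z + 1))))%C
      with ((Cpoch z (1 + S n)) / (RtoC (INR (fact n)) * Crpow (INR n) (z + 1)))%C.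
    2:{ rewrite Cpoch_add; simpl; unfold Cdiv; ring. }
    replace (1 + S n)%nat with (S (S n)) by lia.
    rewrite Crpow_plus; change (RtoC 1) with (RtoC (INR 1)) at 3; rewrite (Crpow_nat _ 1) by auto.
    rewrite pow_1, RtoC_inv by lra.
    change (Cpoch z (S (S n))) with (Cpoch z (S n) * (z + RtoC (INR (S n))))%C.
    rewrite S_INR, RtoC_plus.
    pose proof (Crpow_neq_0 (INR n) z); pose proof (RtoC_fact_neq_0 n).
    field; auto.
  - replace (rgamma z) with (rgamma z * (1 + (z + 1) * RtoC 0))%C by ring.
    apply filterlim_C_mult; [apply rgamma_lim|].
    apply filterlim_C_iff; split; simpl.
    + apply is_lim_seq_plus'; [apply is_lim_seq_const|].
      apply is_lim_seq_minus'; apply is_lim_seq_mult';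
        try apply is_lim_seq_const; apply is_lim_seq_inv_INR.
    + apply is_lim_seq_plus'; [apply is_lim_seq_const|].
      apply is_lim_seq_plus'; apply is_lim_seq_mult';
        try apply is_lim_seq_const; apply is_lim_seq_inv_INR.
Qed.

Lemma rgamma_poch z k : rgamma z = (Cpoch z k * rgamma (z + RtoC (INR k)))%C.
Proof.
  induction k as [|k IH].
  - simpl; rewrite Cplus_0_r; ring.
  - rewrite IH, (rgamma_step (z + RtoC (INR k))); simpl Cpoch.
    rewrite S_INR, RtoC_plus, <- Cplus_assoc; ring.
Qed.

Lemma Cpoch_1 k : Cpoch 1 k = RtoC (INR (fact k)).
Proof.
  induction k as [|k IH]; [reflexivity|].
  rewrite fact_simpl, mult_INR, S_INR, RtoC_mult, RtoC_plus; simpl Cpoch; rewrite IH; ring.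
Qed.

Lemma rgamma_1 : rgamma 1 = RtoC 1.
Proof.
  apply Clim_seq_unique.
  apply (filterlim_ext_loc (fun n => RtoC (1 + / INR n))).
  - exists 1%nat; intros n Hn.
    assert (H1 : 0 < INR n) by (apply lt_0_INR; lia).
    assert (N1 : RtoC (INR n) <> 0) by (apply RtoC_neq_0; lra).
    rewrite Cpoch_1; change (RtoC 1) with (RtoC (INR 1)); rewrite Crpow_nat by auto.
    rewrite fact_simpl, mult_INR, S_INR, pow_1, RtoC_mult, !RtoC_plus, RtoC_inv by lra.
    pose proof (RtoC_fact_neq_0 n); simpl INR; field; auto.
  - apply filterlim_C_iff; split; simpl; [|apply is_lim_seq_const].
    replace (Finite 1) with (Finite (1 + 0)) by (f_equal; ring).
    apply is_lim_seq_plus'; [apply is_lim_seq_const|apply is_lim_seq_inv_INR].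
Qed.

Lemma rgamma_nat k : rgamma (RtoC (INR (S k))) = RtoC (/ INR (fact k)).
Proof.
  pose proof (rgamma_poch 1 k) as H; rewrite rgamma_1, Cpoch_1 in H.
  rewrite S_INR, RtoC_plus, Cplus_comm, RtoC_inv by apply INR_fact_neq_0.
  pose proof (RtoC_fact_neq_0 k) as N.
  apply (f_equal (fun x => / RtoC (INR (fact k)) * x)%C) in H.
  rewrite Cmult_1_r in H; rewrite H; field; exact N.
Qed.

Lemma rgamma_nonpos k : rgamma (- RtoC (INR k)) = RtoC 0.
Proof.
  rewrite (rgamma_poch _ (S k)); simpl Cpoch.
  replace (- RtoC (INR k) + RtoC (INR k))%C with (RtoC 0) by ring; ring.
Qed.

Lemma Cinv_0 : (/ RtoC 0)%C = RtoC 0.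
Proof. apply Ceq; simpl; unfold Rdiv; ring. Qed.

Lemma CGamma_poch z k : (forall j, (j < k)%nat -> (z + RtoC (INR j) <> 0)%C) ->
  CGamma (z + RtoC (INR k)) = (CGamma z * Cpoch z k)%C.
Proof.
  intros H; unfold CGamma; rewrite (rgamma_poch z k).
  assert (N : Cpoch z k <> 0).
  { induction k as [|k IH]; simpl; [apply C1_nz|].
    apply Cmult_neq_0; [apply IH; intros; apply H; lia|apply H; lia]. }
  set (g := rgamma (z + RtoC (INR k))).
  (* If [z + k] is a pole of Gamma, both sides are 0 by the convention [/ 0 = 0]. *)
  destruct (Ceq_dec g 0) as [E|E].
  - rewrite E, Cmult_0_r, Cinv_0; ring.
  - field; auto.
Qed.

(** * Wallis integrals and 1/Gamma at half-integers *)

Definition wallis (k : nat) : R := RInt (fun t => sin t ^ k) 0 PI.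

Lemma ex_RInt_sin_pow k a b : ex_RInt (fun t => sin t ^ k) a b.
Proof.
  apply @ex_RInt_continuous; intros t _.
  apply (ex_derive_continuous (K := R_AbsRing) (V := R_NormedModule)).
  auto_derive; auto.
Qed.

(** The integrand of the difference is the derivative of [- cos t * sin t ^ (k+1)], which vanishes
    at 0 and at pi. *)
Lemma wallis_step k : INR (S (S k)) * wallis (S (S k)) = INR (S k) * wallis k.
Proof.
  unfold wallis; apply Rminus_diag_uniq.
  transitivity (RInt (fun t => INR (S (S k)) * sin t ^ S (S k) - INR (S k) * sin t ^ k) 0 PI).
  { symmetry; apply is_RInt_unique.
    apply @is_RInt_minus; apply @is_RInt_scal, @RInt_correct, ex_RInt_sin_pow. }
  apply is_RInt_unique.
  replace 0 with (- cos PI * sin PI ^ S k - - cos 0 * sin 0 ^ S k) at 2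
    by (rewrite sin_PI, sin_0; simpl; ring).
  apply (is_RInt_derive (V := R_CompleteNormedModule) (fun t => - cos t * sin t ^ S k)).
  - intros t _.
    evar_last.
    { apply @is_derive_mult; [|apply is_derive_pow, is_derive_sin|intros; apply Rmult_comm].
      auto_derive; auto; reflexivity. }
    unfold plus, mult; simpl AbsRing.sort; eqR; simpl pred.
    pose proof (sin2_cos2 t) as SC; unfold Rsqr in SC.
    rewrite !S_INR; simpl.
    replace (sin t * (sin t * sin t ^ k)) with ((1 - cos t * cos t) * sin t ^ k)
      by (rewrite <- SC; ring).
    transitivity ((sin t * sin t - (INR k + 1) * (cos t * cos t)) * sin t ^ k); [ring|].
    replace (sin t * sin t) with (1 - cos t * cos t) by lra; ring.
  - intros t _.
    apply (ex_derive_continuous (K := R_AbsRing) (V := R_NormedModule)).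
    auto_derive; auto.
Qed.

Lemma wallis_even n : wallis (2 * n) = PI * rpoch (/ 2) n / INR (fact n).
Proof.
  induction n as [|n IH].
  - unfold wallis; simpl; rewrite RInt_const; unfold scal; simpl; unfold mult; simpl; field.
  - pose proof (wallis_step (2 * n)) as H; rewrite IH in H.
    replace (2 * S n)%nat with (S (S (2 * n))) by lia.
    rewrite !S_INR, mult_INR in H; change (INR 2) with 2 in H.
    pose proof (pos_INR n).
    apply Rmult_eq_reg_l with (2 * INR n + 1 + 1); [|lra].
    rewrite H, fact_simpl, mult_INR, S_INR; simpl rpoch.
    field; split; [apply INR_fact_neq_0|lra].
Qed.

Lemma wallis_odd n : wallis (2 * n + 1) = INR (fact n) / rpoch (/ 2) (S n).
Proof.
  induction n as [|n IH].
  - unfold wallis; rewrite (is_RInt_unique _ _ _ (- cos PI - - cos 0)).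
    + rewrite cos_PI, cos_0; simpl; field.
    + apply (is_RInt_ext sin); [intros t _; eqR; simpl; ring|].
      apply (is_RInt_derive (V := R_CompleteNormedModule) (fun t => - cos t)).
      * intros t _; auto_derive; auto; ring.
      * intros t _; apply continuous_sin.
  - pose proof (wallis_step (2 * n + 1)) as H; rewrite IH in H.
    replace (2 * S n + 1)%nat with (S (S (2 * n + 1))) by lia.
    rewrite !S_INR, plus_INR, mult_INR in H; change (INR 2) with 2 in H; change (INR 1) with 1 in H.
    pose proof (pos_INR n).
    apply Rmult_eq_reg_l with (2 * INR n + 1 + 1 + 1); [|lra].
    rewrite H, fact_simpl, mult_INR, S_INR.
    change (rpoch (/ 2) (S (S n))) with (rpoch (/ 2) (S n) * (/ 2 + INR (S n))).
    rewrite S_INR; pose proof (rpoch_pos (/ 2) (S n) ltac:(lra)).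
    field; split; lra.
Qed.

Lemma wallis_decr k : wallis (S k) <= wallis k.
Proof.
  pose proof PI_RGT_0.
  apply RInt_le; [lra| | |]; try apply ex_RInt_sin_pow.
  intros t Ht; pose proof (sin_gt_0 t ltac:(lra) ltac:(lra)); pose proof (SIN_bound t).
  simpl; rewrite <- (Rmult_1_l (sin t ^ k)) at 2; apply Rmult_le_compat_r; [apply pow_le|]; lra.
Qed.

Lemma Cpoch_R x k : Cpoch (RtoC x) k = RtoC (rpoch x k).
Proof.
  induction k as [|k IH]; [reflexivity|].
  simpl; rewrite IH, RtoC_mult, RtoC_plus; reflexivity.
Qed.

(** [T N] is Gauss' product at 1/2. The monotonicity of the Wallis integrals at [2N], [2N+1], [2N+2]
    encloses its square between two sequences with limit [1 / PI]. *)
Lemma rgamma_half : rgamma (RtoC (/ 2)) = RtoC (/ sqrt PI).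
Proof.
  pose proof PI_RGT_0 as Hpi.
  set (T := fun N => rpoch (/ 2) (S N) / (INR (fact N) * sqrt (INR N))).
  assert (HT : forall N, (0 < N)%nat ->
    / PI * (1 + / INR N * / 2) <= T N ^ 2 <= / PI * (1 + / INR N)).
  { intros N HN.
    assert (N0 : 0 < INR N) by (apply lt_0_INR; auto).
    pose proof (rpoch_pos (/ 2) (S N) ltac:(lra)) as Hr.
    pose proof (INR_fact_lt_0 N) as Hf.
    pose proof (wallis_decr (2 * N)) as D1.
    replace (S (2 * N)) with (2 * N + 1)%nat in D1 by lia.
    pose proof (wallis_decr (2 * N + 1)) as D2.
    replace (S (2 * N + 1)) with (2 * S N)%nat in D2 by lia.
    rewrite wallis_odd, wallis_even in D1; rewrite wallis_odd, wallis_even in D2.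
    change (rpoch (/ 2) (S N)) with (rpoch (/ 2) N * (/ 2 + INR N)) in D1, Hr.
    assert (ET : T N ^ 2 = (rpoch (/ 2) (S N) / INR (fact N)) ^ 2 / INR N).
    { unfold T; rewrite <- (sqrt_sqrt (INR N)) at 2 by lra.
      pose proof (sqrt_lt_R0 _ N0); field; split; lra. }
    rewrite ET.
    change (rpoch (/ 2) (S N)) with (rpoch (/ 2) N * (/ 2 + INR N)) in D2 |- *.
    rewrite fact_simpl, mult_INR, S_INR in D2.
    set (p := rpoch (/ 2) N) in *; set (f := INR (fact N)) in *; set (x := INR N) in *.
    assert (Hp : 0 < p) by (apply (rpoch_pos (/ 2) N); lra).
    split.
    - apply Rmult_le_reg_l with (PI * x * f * f / (/ 2 + x)).
      { apply Rmult_lt_0_compat; [|apply Rinv_0_lt_compat; lra]; do 3 (apply Rmult_lt_0_compat; [|lra]); lra. }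
      replace (PI * x * f * f / (/ 2 + x) * (/ PI * (1 + / x * / 2))) with (f * f)
        by (field; repeat split; lra).
      replace (PI * x * f * f / (/ 2 + x) * ((p * (/ 2 + x) / f) ^ 2 / x))
        with (PI * p * (p * (/ 2 + x))) by (field; repeat split; lra).
      apply (Rmult_le_compat_r (f * (p * (/ 2 + x)))) in D1; [|nra].
      replace (f / (p * (/ 2 + x)) * (f * (p * (/ 2 + x)))) with (f * f) in D1 by (field; split; lra).
      replace (PI * p / f * (f * (p * (/ 2 + x)))) with (PI * p * (p * (/ 2 + x))) in D1 by (field; lra).
      exact D1.
    - apply Rmult_le_reg_l with (PI * x * f * f / (x + 1)).
      { apply Rmult_lt_0_compat; [|apply Rinv_0_lt_compat; lra]; do 3 (apply Rmult_lt_0_compat; [|lra]); lra. }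
      replace (PI * x * f * f / (x + 1) * (/ PI * (1 + / x))) with (f * f)
        by (field; repeat split; lra).
      replace (PI * x * f * f / (x + 1) * ((p * (/ 2 + x) / f) ^ 2 / x))
        with (PI * (p * (/ 2 + x)) * (p * (/ 2 + x)) / (x + 1)) by (field; repeat split; lra).
      apply (Rmult_le_compat_r (f * (p * (/ 2 + x)))) in D2; [|nra].
      replace (f / (p * (/ 2 + x)) * (f * (p * (/ 2 + x)))) with (f * f) in D2 by (field; split; lra).
      replace (PI * (p * (/ 2 + x)) / ((x + 1) * f) * (f * (p * (/ 2 + x)))) with
        (PI * (p * (/ 2 + x)) * (p * (/ 2 + x)) / (x + 1)) in D2 by (field; lra).
      exact D2. }
  assert (L2 : is_lim_seq (fun N => T N ^ 2) (/ PI)).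
  { apply (is_lim_seq_le_le_loc (fun N => / PI * (1 + / INR N * / 2)) _
      (fun N => / PI * (1 + / INR N))).
    - exists 1%nat; intros N HN; apply HT; lia.
    - replace (Finite (/ PI)) with (Finite (/ PI * (1 + 0 * / 2))) by (f_equal; ring).
      apply is_lim_seq_mult'; [apply is_lim_seq_const|].
      apply is_lim_seq_plus'; [apply is_lim_seq_const|].
      apply is_lim_seq_mult'; [apply is_lim_seq_inv_INR|apply is_lim_seq_const].
    - replace (Finite (/ PI)) with (Finite (/ PI * (1 + 0))) by (f_equal; ring).
      apply is_lim_seq_mult'; [apply is_lim_seq_const|].
      apply is_lim_seq_plus'; [apply is_lim_seq_const|apply is_lim_seq_inv_INR]. }
  assert (LT : is_lim_seq T (/ sqrt PI)).
  { rewrite <- sqrt_inv.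
    apply (is_lim_seq_ext (fun N => sqrt (T N ^ 2))).
    - intros N; apply sqrt_pow2; apply Rmult_le_pos; [left; apply rpoch_pos; lra|].
      destruct N as [|N]; [simpl; rewrite sqrt_0, Rmult_0_r, Rinv_0; lra|].
      left; apply Rinv_0_lt_compat, Rmult_lt_0_compat; [apply INR_fact_lt_0|].
      apply sqrt_lt_R0, lt_0_INR; lia.
    - apply (is_lim_seq_continuous sqrt); auto.
      apply continuity_pt_sqrt; left; apply Rinv_0_lt_compat; lra. }
  apply Clim_seq_unique.
  apply (filterlim_ext_loc (fun N => RtoC (T N))).
  - exists 1%nat; intros N HN.
    assert (N0 : 0 < INR N) by (apply lt_0_INR; lia).
    pose proof (sqrt_lt_R0 _ N0).
    assert (E : Crpow (INR N) (RtoC (/ 2)) = RtoC (sqrt (INR N))).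
    { rewrite <- (pow_1 (sqrt (INR N))), <- Crpow_half_nat by auto.
      rewrite pow2_sqrt by lra; f_equal; simpl INR; rewrite RtoC_inv by lra.
      unfold Cdiv; ring. }
    rewrite E, Cpoch_R, <- RtoC_mult, <- RtoC_div; [reflexivity|].
    apply Rmult_integral_contrapositive_currified; [apply INR_fact_neq_0|lra].
  - apply filterlim_C_iff; split; simpl; [exact LT|apply is_lim_seq_const].
Qed.

Lemma rgamma_half_nat k :
  rgamma (RtoC (INR k + / 2)) = RtoC (/ (sqrt PI * rpoch (/ 2) k)).
Proof.
  pose proof (rgamma_poch (RtoC (/ 2)) k) as H.
  rewrite rgamma_half, Cpoch_R, <- RtoC_plus, Rplus_comm in H.
  pose proof (rpoch_pos (/ 2) k ltac:(lra)).
  pose proof (sqrt_lt_R0 _ PI_RGT_0).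
  rewrite Rinv_mult, RtoC_mult, H, Cmult_comm, Cmult_assoc, <- RtoC_mult.
  rewrite Rinv_l by lra; ring.
Qed.

(** * Expansion of the Ferrers and Legendre functions *)

Lemma sum_Sn_C (u : nat -> C) n :
  (sum_n (G := C_NormedModule) u (S n) : C) = (sum_n (G := C_NormedModule) u n + u (S n))%C.
Proof. apply (sum_Sn (G := C_NormedModule)). Qed.

Ltac eqC := match goal with |- @eq _ ?a ?b => change (@eq C a b) end.

Lemma gcoef_high d m j : gcoef d m (S d + j) = 0.
Proof.
  induction j as [|j IH].
  - rewrite Nat.add_0_r; simpl; unfold Rdiv; ring.
  - rewrite Nat.add_succ_r; simpl in *; rewrite IH; unfold Rdiv; ring.
Qed.

Lemma gpart_high d m j t : gpart d m (d + j) t = gpoly d m t.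
Proof.
  unfold gpoly, gpart; induction j as [|j IH]; [rewrite Nat.add_0_r; reflexivity|].
  rewrite Nat.add_succ_r, tech5, IH.
  replace (S (d + j)) with (S d + j)%nat by lia; rewrite gcoef_high; ring.
Qed.

(** Leading coefficient of the Ferrers series, equal to [(-1)^m (n+m)! / ((n-m)! m!)] for [m <= n].
    It occurs on both sides of the theorem, so it is never evaluated. *)
Definition fconst (n m : nat) : C :=
  (Cpoch (RtoC (INR n) + 1) m * Cpoch (- RtoC (INR n)) m / RtoC (INR (fact m)))%C.

Lemma ferrers_coef d m l :
  (Cpoch (RtoC (INR (m + d)) + 1) (m + l) * Cpoch (- RtoC (INR (m + d))) (m + l)
   * RtoC (/ INR (fact l)) / RtoC (INR (fact (m + l)))
   = fconst (m + d) m * RtoC (gcoef d m l))%C.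
Proof.
  induction l as [|l IH].
  - rewrite Nat.add_0_r; unfold fconst; simpl gcoef; simpl fact; simpl INR.
    rewrite Rinv_1; unfold Cdiv; ring.
  - rewrite Nat.add_succ_r; simpl Cpoch; simpl gcoef.
    rewrite !fact_simpl, !mult_INR, Rinv_mult.
    pose proof (pos_INR l); pose proof (pos_INR m).
    assert (0 < INR (S l)) by (apply lt_0_INR; lia).
    assert (0 < INR (S (m + l))) by (apply lt_0_INR; lia).
    unfold Rdiv; rewrite !RtoC_mult.
    rewrite (Cmult_assoc (fconst _ _)), (Cmult_assoc (fconst _ _)), <- IH.
    rewrite <- (S_INR l).
    replace (INR l + INR m + 1) with (INR (S (m + l))) by (rewrite S_INR, plus_INR; ring).
    rewrite Rinv_mult, RtoC_mult, !RtoC_inv by (try apply INR_fact_neq_0; lra).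
    assert (N1 : RtoC (INR (S l)) <> 0) by (apply RtoC_neq_0; lra).
    assert (N2 : RtoC (INR (S (m + l))) <> 0) by (apply RtoC_neq_0; lra).
    rewrite ?RtoC_minus, ?RtoC_plus, ?RtoC_mult, ?plus_INR, ?RtoC_plus, ?RtoC_mult.
    pose proof (RtoC_fact_neq_0 l); pose proof (RtoC_fact_neq_0 (m + l)).
    field; auto.
Qed.

(** The regularised series starts only at index [m], because 1/Gamma vanishes at the non-positive
    integers [1 - m + k]; re-indexed from there it is the terminating series [gpoly]. *)
Lemma hyp_ferrers d m t :
  hyp2F1reg (RtoC (INR (m + d)) + 1) (- RtoC (INR (m + d))) (1 - RtoC (INR m))
    (RtoC ((1 - t) / 2))
  = (fconst (m + d) m * RtoC (((1 - t) / 2) ^ m * gpoly d m t))%C.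
Proof.
  apply Cseries_unique.
  set (u := fun k => (_ : C)).
  assert (Z : forall k, (k < m)%nat -> u k = RtoC 0).
  { intros k Hk; unfold u.
    replace (1 - RtoC (INR m) + RtoC (INR k))%C with (- RtoC (INR (m - 1 - k)))%C.
    - rewrite rgamma_nonpos; unfold Cdiv; ring.
    - rewrite !minus_INR by lia; rewrite !RtoC_minus; simpl INR; ring. }
  assert (U : forall l, u (m + l)%nat = (fconst (m + d) m * RtoC (((1 - t) / 2) ^ m)
     * RtoC (gcoef d m l * ((1 - t) / 2) ^ l))%C).
  { intros l; unfold u.
    replace (1 - RtoC (INR m) + RtoC (INR (m + l)))%C with (RtoC (INR (S l))).
    2:{ rewrite S_INR, plus_INR, !RtoC_plus; ring. }
    rewrite rgamma_nat, ferrers_coef, <- RtoC_pow, pow_add, !RtoC_mult; ring. }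
  assert (S : forall j, sum_n (G := C_NormedModule) u (m + j)
    = (fconst (m + d) m * RtoC (((1 - t) / 2) ^ m) * RtoC (gpart d m j t))%C).
  { assert (S0 : forall k, (k < m)%nat -> sum_n (G := C_NormedModule) u k = RtoC 0).
    { induction k as [|k IH]; intros Hk; [rewrite sum_O; apply Z; auto|].
      rewrite sum_Sn, IH, Z by lia; unfold plus; simpl; ring. }
    induction j as [|j IH].
    - specialize (U O); rewrite Nat.add_0_r in *.
      assert (E : sum_n (G := C_NormedModule) u m = u m).
      { destruct m as [|m']; [apply sum_O|].
        rewrite sum_Sn, S0 by lia; unfold plus; simpl; ring. }
      rewrite E, U; reflexivity.
    - rewrite Nat.add_succ_r, sum_Sn_C, IH, <- Nat.add_succ_r, U.
      change (gpart d m (S j) t) with (gpart d m j t + gcoef d m (S j) * ((1 - t) / 2) ^ S j).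
      rewrite RtoC_plus; eqC; ring. }
  apply (filterlim_ext_loc (fun _ => fconst (m + d) m * RtoC (((1 - t) / 2) ^ m * gpoly d m t))%C).
  - exists (m + d)%nat; intros n Hn.
    replace n with (m + (d + (n - m - d)))%nat by lia.
    rewrite S, gpart_high, RtoC_mult.
    eqC; ring.
  - apply filterlim_C_const.
Qed.

(** With [(1 + cos th) / (1 - cos th) = (sin th / (1 - cos th))^2], the prefactor times
    [((1 - cos th) / 2)^m] becomes [(sin th / 2)^m]. *)
Lemma ferrers_gpoly d m th : 0 < th < PI ->
  FerrersP (RtoC (INR m)) (RtoC (INR (m + d))) (cos th)
  = (fconst (m + d) m * RtoC ((sin th / 2) ^ m * gpoly d m (cos th)))%C.
Proof.
  intros Hth; unfold FerrersP; rewrite hyp_ferrers.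
  pose proof (sin_gt_0 th ltac:(lra) ltac:(lra)) as Hs.
  assert (Hc : cos th < 1).
  { pose proof (sin2_cos2 th) as E; unfold Rsqr in E.
    pose proof (COS_bound th); nra. }
  replace ((1 + cos th) / (1 - cos th)) with ((sin th / (1 - cos th)) ^ 2).
  - rewrite Crpow_half_nat by (apply Rdiv_lt_0_compat; lra).
    rewrite !RtoC_mult, !Cmult_assoc, (Cmult_comm (RtoC _) (fconst _ _)).
    rewrite <- (Cmult_assoc (fconst _ _)), <- RtoC_mult, <- Rpow_mult_distr.
    do 3 f_equal; f_equal; field; lra.
  - replace (1 + cos th) with (sin th ^ 2 / (1 - cos th)); [field; lra|].
    replace (sin th ^ 2) with ((1 - cos th) * (1 + cos th)); [field; lra|].
    pose proof (sin2_cos2 th) as E; unfold Rsqr in E; simpl; lra.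
Qed.

(** The two upper parameters of Q differ by 1/2, so their Pochhammer symbols merge into a single one
    of even length. *)
Lemma Cpoch_double A k :
  (Cpoch ((A + 1) / 2) k * Cpoch (A / 2) k * RtoC (4 ^ k))%C = Cpoch A (2 * k).
Proof.
  induction k as [|k IH]; [simpl; ring|].
  replace (2 * S k)%nat with (S (S (2 * k))) by lia.
  set (N := (2 * k)%nat) in *.
  change (Cpoch A (S (S N))) with
    (Cpoch A N * (A + RtoC (INR N)) * (A + RtoC (INR (S N))))%C.
  rewrite <- IH, S_INR; unfold N; rewrite mult_INR, RtoC_plus, RtoC_mult.
  simpl; rewrite !RtoC_mult, !RtoC_plus; field.
Qed.

Lemma kernel_series_bound m N (a : C) x th th' : 1 < x ->
  Cmod (Cpoch a N * RtoC ((/ x) ^ N * kernel m N (cos th) (cos th')))%C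
  <= rpoch (Cmod a + 1) N / INR (fact N) * (/ x) ^ N.
Proof.
  intros Hx; assert (0 < / x) by (apply Rinv_0_lt_compat; lra).
  rewrite Cmod_mult, Cmod_R, Rabs_mult, (Rabs_right ((/ x) ^ N)) by
    (apply Rle_ge, pow_le; lra).
  replace (rpoch (Cmod a + 1) N / INR (fact N) * (/ x) ^ N) with
    (rpoch (Cmod a + 1) N * ((/ x) ^ N * / INR (fact N))) by (unfold Rdiv; ring).
  apply Rmult_le_compat; [apply Cmod_ge_0| |apply Cmod_poch_le|].
  - apply Rmult_le_pos; [apply pow_le; lra|apply Rabs_pos].
  - apply Rmult_le_compat_l; [apply pow_le; lra|apply kernel_le].
Qed.

Lemma ex_series_kernel_bound (a : C) x : 1 < x ->
  ex_series (fun N => rpoch (Cmod a + 1) N / INR (fact N) * (/ x) ^ N).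
Proof.
  intros Hx; apply ex_series_rpoch; [pose proof (Cmod_ge_0 a); lra|].
  split; [left; apply Rinv_0_lt_compat; lra|].
  rewrite <- Rinv_1; apply Rinv_lt_contravar; lra.
Qed.

Lemma sum_n_RtoC (c : C) (u : nat -> R) n :
  (sum_n (G := C_NormedModule) (fun k => c * RtoC (u k))%C n : C) = (c * RtoC (sum_f_R0 u n))%C.
Proof.
  induction n as [|n IH]; [rewrite sum_O; reflexivity|].
  rewrite sum_Sn_C, IH, tech5, RtoC_plus; ring.
Qed.

(* Each power of [chi = (x - p) / S] is expanded in [p / x] by the binomial
   series, and the double series is summed along [2 k + j = N]. *)
Lemma hyp_kernel_series m (a : C) x th th' :
  1 < x -> 0 < th < PI -> 0 < th' < PI ->
  let S := sin th * sin th' in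
  let chi := (x - cos th * cos th') / S in
  exists l, is_series (V := C_NormedModule)
    (fun N => Cpoch a N * RtoC ((/ x) ^ N * kernel m N (cos th) (cos th')))%C l /\
  (hyp2F1reg ((a + 1) / 2) (a / 2) (RtoC (INR (m + 1))) (RtoC (/ (chi ^ 2))) / Crpow chi a
   = Crpow S a / Crpow x a * l)%C.
Proof.
  intros Hx Hth Hth' S chi.
  pose proof (sin_gt_0 th ltac:(lra) ltac:(lra)) as Hs.
  pose proof (sin_gt_0 th' ltac:(lra) ltac:(lra)) as Hs'.
  assert (HS : 0 < S) by (unfold S; apply Rmult_lt_0_compat; auto).
  set (p := cos th * cos th') in *.
  assert (Hp : Rabs p < 1).
  { pose proof (Rabs_cos_sin_le th th') as B; fold p in B; fold S in B.
    rewrite (Rabs_right S) in B by lra; lra. }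
  assert (Hpx : Rabs (p / x) < 1).
  { unfold Rdiv; rewrite Rabs_mult, (Rabs_right (/ x)) by (left; apply Rinv_0_lt_compat; lra).
    apply Rmult_lt_reg_r with x; [lra|].
    rewrite Rmult_assoc, Rinv_l by lra; lra. }
  assert (H1 : 0 < 1 - p / x) by (apply Rabs_def2 in Hpx; lra).
  assert (Hxp : 0 < x - p) by (apply Rabs_def2 in Hp; lra).
  assert (Hchi : 0 < chi) by (apply Rdiv_lt_0_compat; auto).
  set (c := fun k => / (4 ^ k * INR (fact k) * INR (fact (m + k)))).
  (* Cell [(k, j)]: the [j]-th binomial term of the [k]-th hypergeometric term, with
     [(a)_(2k) (a+2k)_j] merged into [(a)_(2k+j)]. *)
  set (f := fun k j => (Cpoch a (2 * k + j)
    * RtoC ((/ x) ^ (2 * k + j) * (c k * (S ^ 2) ^ k * p ^ j / INR (fact j))))%C).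
  assert (Dg : forall N k, diag (RtoC 0) f N k
    = (Cpoch a N * RtoC ((/ x) ^ N * (kcoef m N k * p ^ (N - 2 * k) * (S ^ 2) ^ k)))%C).
  { intros N k; unfold diag, f, kcoef.
    destruct (Nat.leb_spec (2 * k) N) as [L|L]; [|rewrite !Rmult_0_l, Rmult_0_r; ring].
    replace (2 * k + (N - 2 * k))%nat with N by lia.
    do 3 f_equal; unfold c, Rdiv; rewrite !Rinv_mult; ring. }
  set (hk := fun k => (Cpoch ((a + 1) / 2) k * Cpoch (a / 2) k
      * rgamma (RtoC (INR (m + 1)) + RtoC (INR k))
      / RtoC (INR (fact k)) * RtoC (/ (chi ^ 2)) ^ k)%C).
  destruct (series_diag_C f (fun k => hk k * Crpow (1 - p / x) (- a))%C
    (fun N => Cpoch a N * RtoC ((/ x) ^ N * kernel m N (cos th) (cos th')))%C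
    (fun N => rpoch (Cmod a + 1) N / INR (fact N) * (/ x) ^ N)) as [l [L1 L2]].
  - intros k.
    assert (B := binomial_series (a + RtoC (INR (2 * k))) (p / x) Hpx).
    set (g := (Cpoch a (2 * k) * RtoC ((/ x) ^ (2 * k) * (c k * (S ^ 2) ^ k)))%C).
    apply (is_series_scal (V := C_NormedModule) g) in B.
    (* The row sum has exponent [-(a + 2k)]. Its integer part rebuilds [chi^(-2k)]; the rest,
       [(1 - p/x)^(-a)], is common to all rows. *)
    assert (E : (g * Crpow (1 - p / x) (- (a + RtoC (INR (2 * k)))))%C
      = (hk k * Crpow (1 - p / x) (- a))%C).
    { replace (- (a + RtoC (INR (2 * k))))%C with (- a + - RtoC (INR (2 * k)))%C by ring.
      rewrite Crpow_plus, (Crpow_opp _ (RtoC _)), Crpow_nat by auto.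
      unfold g, hk; rewrite <- Cpoch_double.
      replace (RtoC (INR (m + 1)) + RtoC (INR k))%C with (RtoC (INR (Datatypes.S (m + k))))
        by (rewrite <- RtoC_plus, <- plus_INR; do 2 f_equal; lia).
      rewrite rgamma_nat, <- RtoC_pow.
      rewrite <- RtoC_inv by (apply pow_nonzero; lra).
      unfold Cdiv; rewrite <- (RtoC_inv (INR (fact k))) by apply INR_fact_neq_0.
      transitivity (Cpoch ((a + 1) * / 2) k * Cpoch (a * / 2) k * Crpow (1 - p / x) (- a)
        * RtoC (/ INR (fact (m + k)) * / INR (fact k) * (/ chi ^ 2) ^ k))%C;
        [|eqC; rewrite !RtoC_mult; ring].
      transitivity (Cpoch ((a + 1) * / 2) k * Cpoch (a * / 2) k * Crpow (1 - p / x) (- a)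
        * RtoC (4 ^ k * ((/ x) ^ (2 * k) * (c k * (S ^ 2) ^ k)) * / (1 - p / x) ^ (2 * k)))%C;
        [eqC; rewrite !RtoC_mult; ring|].
      f_equal; f_equal.
      rewrite !pow_mult.
      replace (/ chi ^ 2) with (S ^ 2 * ((/ x) ^ 2) * / (1 - p / x) ^ 2).
      2:{ unfold chi; replace (x - p) with (x * (1 - p / x)) by (field; lra).
          field; repeat split; lra. }
      rewrite !Rpow_mult_distr, (pow_inv ((1 - p / x) ^ 2)); unfold c.
      generalize (((/ x) ^ 2) ^ k); intros y.
      assert (0 < 4 ^ k) by (apply pow_lt; lra).
      assert (0 < ((1 - p / x) ^ 2) ^ k) by (apply pow_lt, pow_lt; lra).
      field; repeat split; try apply INR_fact_neq_0; lra. }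
    rewrite <- E.
    eapply is_series_ext; [|exact B]; intros j.
    change (scal g ?y) with (g * y)%C; unfold g, f, bcoef, Cdiv.
    rewrite Cpoch_add, pow_add, <- (RtoC_inv (INR (fact j))) by apply INR_fact_neq_0.
    unfold Rdiv; rewrite (Rpow_mult_distr p), !RtoC_mult; eqC; ring.
  - intros N; eqC.
    rewrite kernelE.
    assert (E : sum_f_R0 (fun k => kcoef m N k * (cos th * cos th') ^ (N - 2 * k)
       * ((1 - cos th ^ 2) * (1 - cos th' ^ 2)) ^ k) N
       = sum_f_R0 (fun k => kcoef m N k * p ^ (N - 2 * k) * (S ^ 2) ^ k) N).
    { apply sum_eq; intros k _; f_equal; f_equal; unfold S.
      pose proof (sin2_cos2 th) as E1; pose proof (sin2_cos2 th') as E2; unfold Rsqr in *.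
      replace (1 - cos th ^ 2) with (sin th ^ 2) by (simpl; lra).
      replace (1 - cos th' ^ 2) with (sin th' ^ 2) by (simpl; lra); ring. }
    rewrite E, RtoC_mult, Cmult_assoc, <- sum_n_RtoC.
    apply sum_n_ext; intros k; rewrite Dg, (RtoC_mult ((/ x) ^ N)); eqC; ring.
  - intros N.
    apply Rle_trans with (Cmod (Cpoch a N) * (/ x) ^ N *
      sum_f_R0 (fun k => kcoef m N k * Rabs p ^ (N - 2 * k) * (Rabs S ^ 2) ^ k) N).
    + rewrite scal_sum; apply Req_le, sum_eq; intros k _.
      rewrite Dg, Cmod_mult, Cmod_R, !Rabs_mult.
      rewrite (Rabs_right ((/ x) ^ N)) by (apply Rle_ge, pow_le; left; apply Rinv_0_lt_compat; lra).
      rewrite (Rabs_right (kcoef _ _ _)) by (apply Rle_ge, kcoef_pos).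
      rewrite <- !RPow_abs; ring.
    + replace (rpoch (Cmod a + 1) N / INR (fact N) * (/ x) ^ N) with
        (rpoch (Cmod a + 1) N * (/ x) ^ N * / INR (fact N)) by (unfold Rdiv; ring).
      assert (0 <= (/ x) ^ N) by (apply pow_le; left; apply Rinv_0_lt_compat; lra).
      apply Rmult_le_compat; [apply Rmult_le_pos; auto using Cmod_ge_0| | |].
      * apply cond_pos_sum; intros k; apply Rmult_le_pos; [apply Rmult_le_pos|].
        -- apply kcoef_pos.
        -- apply pow_le, Rabs_pos.
        -- apply pow_le, pow2_ge_0.
      * apply Rmult_le_compat_r; auto using Cmod_poch_le.
      * apply kernel_abs_sum_le.
  - apply ex_series_kernel_bound, Hx.
  - exists l; split; [exact L2|].
    (* The common factor is moved to the other side, where it cancels the [(1 - p/x)^a] contained in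
       [chi^a]. *)
    assert (Eh : hyp2F1reg ((a + 1) / 2) (a / 2) (RtoC (INR (m + 1))) (RtoC (/ (chi ^ 2)))
      = (l * Crpow (1 - p / x) a)%C).
    { apply Cseries_unique.
      apply (is_series_scal (V := C_NormedModule) (Crpow (1 - p / x) a)) in L1.
      replace (l * Crpow (1 - p / x) a)%C with (scal (Crpow (1 - p / x) a : C_AbsRing) l)
        by apply Cmult_comm.
      eapply is_series_ext; [|exact L1]; intros k.
      change (scal ?u ?v) with (u * v)%C; eqC; fold (hk k).
      rewrite Crpow_opp; field; apply Crpow_neq_0. }
    rewrite Eh.
    replace chi with (x * (1 - p / x) / S) by (unfold chi; field; lra).
    rewrite Crpow_div, Crpow_mult by (auto; try lra; apply Rmult_lt_0_compat; lra).
    pose proof (Crpow_neq_0 x a); pose proof (Crpow_neq_0 S a); pose proof (Crpow_neq_0 (1 - p / x) a).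
    field; auto.
Qed.

Lemma is_series_sparse (u : nat -> C) (l : C) d :
  (forall N, (N < d)%nat -> u N = RtoC 0) ->
  (forall k, u (d + (2 * k + 1))%nat = RtoC 0) ->
  is_series (V := C_NormedModule) u l ->
  is_series (V := C_NormedModule) (fun k => u (d + 2 * k)%nat) l.
Proof.
  intros Hlow Hodd Hu.
  assert (S0 : forall N, (N < d)%nat -> sum_n (G := C_NormedModule) u N = RtoC 0).
  { induction N as [|N IH]; intros HN; [rewrite sum_O; auto|].
    eqC; rewrite sum_Sn_C, IH, Hlow by lia; ring. }
  assert (E : forall k, (sum_n (G := C_NormedModule) (fun k => u (d + 2 * k)%nat) k : C)
    = sum_n (G := C_NormedModule) u (d + 2 * k)).
  { induction k as [|k IH].
    - rewrite sum_O, Nat.mul_0_r, Nat.add_0_r.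
      destruct d as [|d]; [rewrite sum_O; reflexivity|].
      rewrite sum_Sn_C, S0 by lia; ring.
    - rewrite sum_Sn_C, IH.
      assert (Eo : (sum_n (G := C_NormedModule) u (d + (2 * k + 1)) : C)
        = sum_n (G := C_NormedModule) u (d + 2 * k)).
      { specialize (Hodd k).
        replace (d + (2 * k + 1))%nat with (S (d + 2 * k)) in * by lia.
        rewrite sum_Sn_C, Hodd; ring. }
      replace (d + 2 * S k)%nat with (S (d + (2 * k + 1))) by lia.
      rewrite sum_Sn_C, Eo; reflexivity. }
  unfold is_series.
  eapply filterlim_ext; [intros k; symmetry; apply E|].
  apply (filterlim_comp _ _ _ (fun k => (d + 2 * k)%nat)
    (sum_n (G := C_NormedModule) u) _ eventually); [|exact Hu].
  intros P [N HN]; exists N; intros k Hk; apply HN; lia.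
Qed.

(** Only [N = d + 2k] survives in the moment series. There [(a)_N = (a)_d (a+d)_(2k)], and the
    duplication formula splits the second factor into the upper parameters of the right-hand Q. *)
Lemma hyp_sparse_series d m (a : C) x (V : C) : 1 < x ->
  (forall j : nat, (a + RtoC (INR j) <> 0)%C) ->
  is_series (V := C_NormedModule)
    (fun N => Cpoch a N * RtoC ((/ x) ^ N * (gmom d m N / (INR (fact m) * INR (fact N)))))%C V ->
  hyp2F1reg ((a + RtoC (INR d) + 1) / 2) ((a + RtoC (INR d)) / 2)
    (RtoC (INR (m + d) + 3 / 2)) (RtoC (/ (x ^ 2)))
  = (V * RtoC ((2 * x) ^ d) / (Cpoch a d * RtoC (sqrt PI)))%C.
Proof.
  intros Hx Ha HV; apply Cseries_unique.
  assert (Nd : Cpoch a d <> 0).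
  { clear - Ha; induction d as [|d IH]; simpl; [apply C1_nz|apply Cmult_neq_0; auto]. }
  pose proof (sqrt_lt_R0 _ PI_RGT_0) as Hpi.
  assert (Npi : RtoC (sqrt PI) <> 0) by (apply RtoC_neq_0; lra).
  apply (is_series_sparse _ _ d) in HV.
  2:{ intros N HN; rewrite gmom_low by exact HN; unfold Rdiv; rewrite Rmult_0_l, Rmult_0_r; ring. }
  2:{ intros k; rewrite gmom_odd; unfold Rdiv; rewrite Rmult_0_l, Rmult_0_r; ring. }
  set (g := (RtoC ((2 * x) ^ d) / (Cpoch a d * RtoC (sqrt PI)))%C).
  apply (is_series_scal (V := C_NormedModule) g) in HV.
  replace (V * RtoC ((2 * x) ^ d) / (Cpoch a d * RtoC (sqrt PI)))%C with (scal (g : C_AbsRing) V).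
  2:{ change (scal g V) with (g * V)%C; eqC; unfold g, Cdiv; ring. }
  eapply is_series_ext; [|exact HV]; intros k.
  change (scal ?u ?v) with (u * v)%C; eqC; cbv beta.
  rewrite gmom_even, Cpoch_add, <- Cpoch_double.
  replace (RtoC (INR (m + d) + 3 / 2) + RtoC (INR k))%C with
    (RtoC (INR (m + d + 1 + k) + / 2)).
  2:{ rewrite <- RtoC_plus; f_equal; rewrite !plus_INR; simpl INR; field. }
  rewrite rgamma_half_nat.
  pose proof (rpoch_pos (/ 2) (m + d + 1 + k) ltac:(lra)) as Hr.
  unfold g, Cdiv; rewrite <- RtoC_pow, <- (RtoC_inv (INR (fact k))) by apply INR_fact_neq_0.
  transitivity (Cpoch ((a + RtoC (INR d) + 1) * / 2) k * Cpoch ((a + RtoC (INR d)) * / 2) k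
     * RtoC (/ (sqrt PI * rpoch (/ 2) (m + d + 1 + k)) * / INR (fact k) * (/ x ^ 2) ^ k))%C;
    [|rewrite !RtoC_mult; ring].
  replace (/ (Cpoch a d * RtoC (sqrt PI)))%C with (/ Cpoch a d * / RtoC (sqrt PI))%C
    by (field; auto).
  transitivity (Cpoch ((a + RtoC (INR d) + 1) * / 2) k * Cpoch ((a + RtoC (INR d)) * / 2) k
     * (Cpoch a d * / Cpoch a d) * RtoC ((2 * x) ^ d * / sqrt PI * 4 ^ k * ((/ x) ^ (d + 2 * k)
     * / (2 ^ (d + 2 * k) * INR (fact k) * rpoch (/ 2) (m + d + 1 + k)))))%C.
  { rewrite !RtoC_mult, <- (RtoC_inv (sqrt PI)) by lra; ring. }
  rewrite Cinv_r, Cmult_1_r by exact Nd; f_equal; f_equal.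
  rewrite !pow_add, !pow_mult, Rpow_mult_distr, !pow_inv.
  replace (2 ^ 2) with 4 by ring.
  assert (0 < 2 ^ d) by (apply pow_lt; lra).
  assert (0 < 4 ^ k) by (apply pow_lt; lra).
  assert (0 < x ^ d) by (apply pow_lt; lra).
  assert (0 < (x ^ 2) ^ k) by (apply pow_lt, pow_lt; lra).
  field; repeat split; try apply INR_fact_neq_0; lra.
Qed.

(** * Termwise integration *)

(** Weierstrass' test. Bounds and sums are asked for at every real [t], because uniform convergence
    is taken in the space of functions on the whole line. *)
Lemma is_RInt_series_R (u : nat -> R -> R) (M J : nat -> R) (g : R -> R) a b :
  (forall N t, Rabs (u N t) <= M N) -> ex_series M ->
  (forall N, is_RInt (u N) a b (J N)) ->
  (forall t, is_series (fun N => u N t) (g t)) ->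
  exists l, is_series J l /\ is_RInt g a b l.
Proof.
  intros Hu [m Hm] HJ Hg.
  assert (HM0 : forall N, 0 <= M N)
    by (intros N; eapply Rle_trans; [apply Rabs_pos|apply (Hu N 0)]).
  apply (filterlim_RInt (V := R_CompleteNormedModule)
    (fun n t => sum_n (fun N => u N t) n) a b eventually _ g (sum_n J)).
  - intros n; induction n as [|n IH].
    + rewrite sum_O; eapply is_RInt_ext; [|apply HJ]; intros t _; rewrite sum_O; reflexivity.
    + rewrite sum_Sn; eapply is_RInt_ext; [|apply @is_RInt_plus; [exact IH|apply HJ]].
      intros t _; simpl; rewrite sum_Sn; reflexivity.
  - apply filterlim_locally; intros eps.
    assert (T : forall n t, Rabs (g t - sum_n (fun N => u N t) n) <= m - sum_f_R0 M n).
    { intros n t.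
      assert (L : is_lim_seq (fun j => Rabs (sum_n (fun N => u N t) (j + n) - sum_n (fun N => u N t) n))
        (Rabs (g t - sum_n (fun N => u N t) n))).
      { apply (is_lim_seq_abs _ (g t - sum_n (fun N => u N t) n)).
        apply is_lim_seq_minus'; [|apply is_lim_seq_const].
        apply (is_lim_seq_incr_n (sum_n (fun N => u N t))); apply (Hg t). }
      apply (fun H => is_lim_seq_le _ _ _ (Finite (m - sum_f_R0 M n)) H L (is_lim_seq_const _)).
      intros j; apply Rle_trans with (sum_f_R0 M (j + n) - sum_f_R0 M n).
      - rewrite !sum_n_Reals; induction j as [|j IH].
        + simpl; rewrite !Rminus_diag, Rabs_R0; lra.
        + simpl Nat.add; rewrite !tech5.
          specialize (Hu (S (j + n)) t).
          match goal with |- Rabs (?x + ?y - ?z) <= _ =>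
            replace (x + y - z) with ((x - z) + y) by ring end.
          eapply Rle_trans; [apply Rabs_triang|]; lra.
      - pose proof (sum_f_R0_le_series M m (j + n) HM0 Hm); lra. }
    assert (Lm : is_lim_seq (sum_n M) m) by exact Hm.
    apply is_lim_seq_spec in Lm; destruct (Lm eps) as [n0 Hn0].
    exists n0; intros n Hn t.
    specialize (Hn0 n Hn); rewrite sum_n_Reals in Hn0.
    change (Rabs (sum_n (fun N => u N t) n - g t) < eps).
    rewrite Rabs_minus_sym; eapply Rle_lt_trans; [apply T|].
    apply Rabs_def2 in Hn0; lra.
Qed.

Lemma is_RInt_C_iff (f : R -> C) a b (l : C) :
  is_RInt (V := C_R_NormedModule) f a b l <->
  is_RInt (fun t => Re (f t)) a b (Re l) /\ is_RInt (fun t => Im (f t)) a b (Im l).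
Proof.
  split.
  - intros H; split.
    + apply (is_RInt_fct_extend_fst (U := R_NormedModule) (V := R_NormedModule) f a b l H).
    + apply (is_RInt_fct_extend_snd (U := R_NormedModule) (V := R_NormedModule) f a b l H).
  - intros [H1 H2]; destruct l as [lr li].
    exact (is_RInt_fct_extend_pair (U := R_NormedModule) (V := R_NormedModule) f a b lr li H1 H2).
Qed.

Lemma is_RInt_C_scal (c : C) (f : R -> C) a b (l : C) :
  is_RInt (V := C_R_NormedModule) f a b l ->
  is_RInt (V := C_R_NormedModule) (fun t => c * f t)%C a b (c * l)%C.
Proof.
  intros H; apply is_RInt_C_iff in H; destruct H as [H1 H2].
  apply is_RInt_C_iff; split; simpl.
  - apply @is_RInt_minus; apply @is_RInt_scal; auto.
  - apply @is_RInt_plus; apply @is_RInt_scal; auto.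
Qed.

Lemma is_RInt_series_C (c : nat -> C) (u : nat -> R -> R) (M J : nat -> R) (g : R -> C) a b :
  (forall N t, Cmod (c N) * Rabs (u N t) <= M N) -> ex_series M ->
  (forall N, is_RInt (u N) a b (J N)) ->
  (forall t, is_series (V := C_NormedModule) (fun N => c N * RtoC (u N t))%C (g t)) ->
  exists l, is_series (V := C_NormedModule) (fun N => c N * RtoC (J N))%C l /\
    is_RInt (V := C_R_NormedModule) g a b l.
Proof.
  intros HM EM HJ Hg.
  assert (B : forall (d : nat -> R), (forall N, Rabs (d N) <= Cmod (c N)) ->
    forall N t, Rabs (d N * u N t) <= M N).
  { intros d Hd N t; eapply Rle_trans; [|apply (HM N t)].
    rewrite Rabs_mult; apply Rmult_le_compat_r; auto using Rabs_pos. }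
  destruct (is_RInt_series_R (fun N t => Re (c N) * u N t) M (fun N => Re (c N) * J N)
    (fun t => Re (g t)) a b) as [lr [R1 R2]]; auto.
  { apply (B (fun N => Re (c N))); intros; apply re_le_Cmod. }
  { intros N; apply @is_RInt_scal, HJ. }
  { intros t; specialize (Hg t); apply is_series_C_iff in Hg; destruct Hg as [H _].
    eapply is_series_ext; [|exact H]; intros N; apply re_scal_r. }
  destruct (is_RInt_series_R (fun N t => Im (c N) * u N t) M (fun N => Im (c N) * J N)
    (fun t => Im (g t)) a b) as [li [I1 I2]]; auto.
  { apply (B (fun N => Im (c N))); intros; apply im_le_Cmod. }
  { intros N; apply @is_RInt_scal, HJ. }
  { intros t; specialize (Hg t); apply is_series_C_iff in Hg; destruct Hg as [_ H].
    eapply is_series_ext; [|exact H]; intros N; apply im_scal_r. }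
  exists (lr, li); split.
  - apply is_series_C_iff; split.
    + eapply is_series_ext; [|exact R1]; intros N; symmetry; apply re_scal_r.
    + eapply is_series_ext; [|exact I1]; intros N; symmetry; apply im_scal_r.
  - apply is_RInt_C_iff; split; auto.
Qed.

Lemma gpoly_bounded d m : exists B, 0 <= B /\ forall th, Rabs (gpoly d m (cos th)) <= B.
Proof.
  exists (sum_f_R0 (fun l => Rabs (gcoef d m l)) d); split.
  - apply cond_pos_sum; intros; apply Rabs_pos.
  - intros th; unfold gpoly, gpart; eapply Rle_trans; [apply Rsum_abs|].
    apply sum_Rle; intros l _; rewrite Rabs_mult, <- RPow_abs.
    rewrite <- (Rmult_1_r (Rabs (gcoef d m l))) at 2.
    apply Rmult_le_compat_l; [apply Rabs_pos|].
    apply Rle_trans with (1 ^ l); [|rewrite pow1; lra].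
    apply pow_incr; split; [apply Rabs_pos|].
    pose proof (COS_bound th); apply Rabs_le; lra.
Qed.

(** The substitution [t = cos th] reverses the orientation, which accounts for the two uses of
    [opp]. *)
Lemma is_RInt_cos_subst f : polynomial f ->
  is_RInt (fun th => f (cos th) * sin th) 0 PI (RInt f (-1) 1).
Proof.
  intros Hf.
  replace (RInt f (-1) 1) with (opp (RInt f (cos 0) (cos PI))).
  2:{ rewrite cos_0, cos_PI; apply (opp_RInt_swap (V := R_CompleteNormedModule)).
      apply polynomial_ex_RInt; auto. }
  apply (is_RInt_ext (fun th => opp (scal (- sin th) (f (cos th))))).
  { intros th _; unfold opp, scal; simpl; unfold mult; simpl; eqR; ring. }
  apply @is_RInt_opp.
  apply (is_RInt_comp (V := R_CompleteNormedModule) f cos (fun th => - sin th)).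
  - intros th _; apply polynomial_continuous; auto.
  - intros th _; split; [auto_derive; auto; ring|].
    apply (ex_derive_continuous (K := R_AbsRing) (V := R_NormedModule)).
    auto_derive; auto.
Qed.

Lemma kernel_polynomial m N s : polynomial (fun t => kernel m N t s).
Proof. unfold kernel; auto 10 with poly. Qed.

Lemma kernel_integral d m N th' :
  is_RInt (fun th => kernel m N (cos th) (cos th')
      * ((sin th ^ 2) ^ m * gpoly d m (cos th) * sin th)) 0 PI
    (gmom d m N / (INR (fact m) * INR (fact N)) * gpoly d m (cos th')).
Proof.
  rewrite <- kernel_eigen; unfold gint.
  pose proof (kernel_polynomial m N (cos th')).
  eapply is_RInt_ext; [|apply is_RInt_cos_subst; auto 10 with poly].
  intros th _; eqR; cbv beta.
  replace (1 - cos th ^ 2) with (sin th ^ 2)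
    by (pose proof (sin2_cos2 th); unfold Rsqr in *; simpl; lra).
  ring.
Qed.

Lemma kernel_series_integral d m (a : C) x th' : 1 < x ->
  exists V, is_series (V := C_NormedModule)
    (fun N => Cpoch a N * RtoC ((/ x) ^ N * (gmom d m N / (INR (fact m) * INR (fact N)))))%C V /\
  exists g : R -> C,
   (forall th, is_series (V := C_NormedModule)
      (fun N => Cpoch a N * RtoC ((/ x) ^ N * kernel m N (cos th) (cos th')))%C (g th)) /\
   is_RInt (V := C_R_NormedModule)
     (fun th => g th * RtoC ((sin th ^ 2) ^ m * gpoly d m (cos th) * sin th))%C 0 PI
     (V * RtoC (gpoly d m (cos th')))%C.
Proof.
  intros Hx; destruct (gpoly_bounded d m) as [B [HB0 HB]].
  set (M := fun N => rpoch (Cmod a + 1) N / INR (fact N) * (/ x) ^ N).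
  assert (EM : ex_series M) by (apply ex_series_kernel_bound; auto).
  set (w := fun th => (sin th ^ 2) ^ m * gpoly d m (cos th) * sin th).
  assert (Hw : forall th, Rabs (w th) <= B).
  { intros th; unfold w; rewrite !Rabs_mult.
    assert (S1 : Rabs (sin th) <= 1) by (pose proof (SIN_bound th); apply Rabs_le; lra).
    assert (S2 : Rabs ((sin th ^ 2) ^ m) <= 1).
    { rewrite <- pow_mult, <- RPow_abs, <- (pow1 (2 * m)).
      apply pow_incr; split; [apply Rabs_pos|exact S1]. }
    specialize (HB th).
    pose proof (Rabs_pos (sin th)); pose proof (Rabs_pos ((sin th ^ 2) ^ m)).
    pose proof (Rabs_pos (gpoly d m (cos th))).
    replace B with (1 * B * 1) by ring.
    apply Rmult_le_compat; auto; [apply Rmult_le_pos; auto|].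
    apply Rmult_le_compat; auto. }
  assert (Eg : forall th, exists l, is_series (V := C_NormedModule)
      (fun N => Cpoch a N * RtoC ((/ x) ^ N * kernel m N (cos th) (cos th')))%C l).
  { intros th; apply (ex_series_C_le _ M); auto; intros N; apply kernel_series_bound; auto. }
  set (g := fun th => Cseries (fun N => Cpoch a N * RtoC ((/ x) ^ N * kernel m N (cos th) (cos th')))%C).
  assert (Hg : forall th, is_series (V := C_NormedModule)
      (fun N => Cpoch a N * RtoC ((/ x) ^ N * kernel m N (cos th) (cos th')))%C (g th)).
  { intros th; destruct (Eg th) as [l Hl]; unfold g; rewrite (Cseries_unique _ l Hl); exact Hl. }
  (* Convergence is proved separately from the integral at [th'], since [gpoly d m (cos th')] may
     vanish and cannot be divided out. At angle 0 [gpoly] is 1, so the normalised moments are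
     themselves integrals of the kernel and inherit its [1/N!] bound. *)
  assert (EV : exists V, is_series (V := C_NormedModule)
    (fun N => Cpoch a N * RtoC ((/ x) ^ N * (gmom d m N / (INR (fact m) * INR (fact N)))))%C V).
  { set (I := fun N => RInt (fun th => kernel m N (cos th) (cos 0)
      * ((sin th ^ 2) ^ m * gpoly d m (cos th) * sin th)) 0 PI).
    assert (EI : forall N, I N = gmom d m N / (INR (fact m) * INR (fact N))).
    { intros N; apply is_RInt_unique; pose proof (kernel_integral d m N 0) as K.
      replace (gpoly d m (cos 0)) with 1 in K by (rewrite cos_0, gpoly_1; reflexivity).
      rewrite Rmult_1_r in K; exact K. }
    apply (ex_series_C_le _ (fun N => PI * B * M N)).
    - intros N; rewrite <- EI, Cmod_mult, Cmod_R.
      pose proof PI_RGT_0.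
      assert (HI : Rabs (I N) <= PI * B * / INR (fact N)).
      { unfold I.
        replace (PI * B * / INR (fact N)) with ((PI - 0) * (B * / INR (fact N))) by ring.
        apply (norm_RInt_le_const (V := R_NormedModule) (fun th => kernel m N (cos th) (cos 0)
          * ((sin th ^ 2) ^ m * gpoly d m (cos th) * sin th)) 0 PI); [lra| |].
        - intros th _; unfold norm; simpl; unfold abs; simpl; rewrite Rabs_mult, Rmult_comm.
          apply Rmult_le_compat; try apply Rabs_pos; [apply (Hw th)|apply kernel_le].
        - apply @RInt_correct; eexists; apply kernel_integral. }
      assert (0 <= (/ x) ^ N) by (apply pow_le; left; apply Rinv_0_lt_compat; lra).
      rewrite Rabs_mult, (Rabs_right ((/ x) ^ N)) by lra.
      replace (PI * B * M N) with (rpoch (Cmod a + 1) N * ((/ x) ^ N * (PI * B * / INR (fact N))))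
        by (unfold M, Rdiv; ring).
      apply Rmult_le_compat; try apply Cmod_ge_0; [|apply Cmod_poch_le|].
      + apply Rmult_le_pos; auto; apply Rabs_pos.
      + apply Rmult_le_compat_l; auto.
    - apply (ex_series_scal (V := R_NormedModule) (PI * B)); exact EM. }
  destruct EV as [V HV].
  exists V; split; [exact HV|]; exists g; split; [exact Hg|].
  destruct (is_RInt_series_C (Cpoch a)
    (fun N th => (/ x) ^ N * (kernel m N (cos th) (cos th') * w th)) (fun N => B * M N)
    (fun N => (/ x) ^ N * (gmom d m N / (INR (fact m) * INR (fact N)) * gpoly d m (cos th')))
    (fun th => g th * RtoC (w th))%C 0 PI) as [l [L1 L2]].
  - intros N th.
    pose proof (kernel_series_bound m N a x th th' Hx) as K.
    rewrite Cmod_mult, Cmod_R in K; rewrite <- Rmult_assoc, Rabs_mult, <- Rmult_assoc, Rmult_comm.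
    apply Rmult_le_compat; auto using Rabs_pos.
    apply Rmult_le_pos; [apply Cmod_ge_0|apply Rabs_pos].
  - apply (ex_series_scal (V := R_NormedModule) B); exact EM.
  - intros N; apply @is_RInt_scal, kernel_integral.
  - intros th; specialize (Hg th).
    apply (is_series_scal (V := C_NormedModule) (RtoC (w th))) in Hg.
    rewrite Cmult_comm.
    eapply is_series_ext; [|exact Hg]; intros N.
    change (scal ?u ?v) with (u * v)%C; eqC; rewrite !RtoC_mult; ring.
  - replace (V * RtoC (gpoly d m (cos th')))%C with l; [exact L2|].
    apply (is_series_scal (V := C_NormedModule) (RtoC (gpoly d m (cos th')))) in HV.
    rewrite <- (Cseries_unique _ _ L1); apply Cseries_unique.
    rewrite Cmult_comm.
    eapply is_series_ext; [|exact HV]; intros N.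
    change (scal ?u ?v) with (u * v)%C; eqC; rewrite !RtoC_mult; ring.
Qed.

(** * Comparison of the two sides of the integral formula *)

Lemma Ci_Cexp (w : C) : (Ci * Cexp (w * RtoC PI * Ci) = Cexp ((w + 1 / 2) * RtoC PI * Ci))%C.
Proof.
  replace ((w + 1 / 2) * RtoC PI * Ci)%C with (w * RtoC PI * Ci + RtoC (PI / 2) * Ci)%C.
  2:{ unfold Rdiv; rewrite RtoC_mult, RtoC_inv by lra; field. }
  rewrite Cexp_plus.
  replace (Cexp (RtoC (PI / 2) * Ci)) with Ci; [ring|].
  unfold Cexp; apply Ceq; simpl;
    rewrite ?Rmult_0_l, ?Rmult_0_r, ?Rmult_1_r, ?Rminus_0_r, ?Rplus_0_r, exp_0, ?cos_PI2, ?sin_PI2; ring.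
Qed.

Lemma Crpow_sqr x (w : C) : 0 < x -> Crpow (x ^ 2) (w / 2) = Crpow x w.
Proof.
  intros Hx; simpl; rewrite Rmult_1_r, Crpow_mult, <- Crpow_plus by auto; f_equal; field.
Qed.

Theorem theorem3p1 (n m : nat) (nu : C) (r r' th' : R) :
  (m <= n)%nat ->
  (forall k : nat, nu <> RtoC (INR (2 * m + 2 * k))) ->
  0 < r -> 0 < r' -> r <> r' ->
  0 < th' < PI ->
  let chi := fun th : R =>
    (r ^ 2 + r' ^ 2 - 2 * r * r' * cos th * cos th')
      / (2 * r * r' * sin th * sin th') in
  let rl := Rmin r r' in
  let rg := Rmax r r' in
  is_RInt (V := C_R_NormedModule)
    (fun th : R =>
       (Crpow (chi th ^ 2 - 1) ((nu + 1) / 4)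
        * LegendreQ (- ((nu + 1) / 2)) (RtoC (INR m) - RtoC (1 / 2)) (chi th)
        * FerrersP (RtoC (INR m)) (RtoC (INR n)) (cos th)
        * Crpow (sin th) ((nu + 2) / 2))%C)
    0 PI
    (Ci * RtoC (sqrt PI)
       / (Crpow 2 ((nu + 1) / 2) * Crpow (sin th') (nu / 2))
       * Crpow ((rg ^ 2 - rl ^ 2) / (r * r')) ((nu + 2) / 2)
       * LegendreQ (- ((nu + 2) / 2)) (RtoC (INR n))
                   ((r ^ 2 + r' ^ 2) / (2 * r * r'))
       * FerrersP (RtoC (INR m)) (RtoC (INR n)) (cos th'))%C.
Proof.
  intros Hmn Hnu Hr Hr' Hrr Hth' chi rl rg.
  set (d := (n - m)%nat); replace n with (m + d)%nat by (unfold d; lia).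
  clearbody d; clear n Hmn.
  set (a := (RtoC (INR m) - nu / 2)%C).
  assert (Ha : forall j : nat, (a + RtoC (INR j) <> 0)%C).
  { intros j E; apply (Hnu j); rewrite plus_INR, !mult_INR, RtoC_plus, !RtoC_mult.
    change (INR 2) with 2.
    replace nu with (2 * (RtoC (INR m) + RtoC (INR j)) - 2 * (a + RtoC (INR j)))%C
      by (unfold a; field).
    rewrite E; ring. }
  set (x := (r ^ 2 + r' ^ 2) / (2 * r * r')).
  assert (Hrr' : 0 < r * r') by nra.
  assert (Hx : 1 < x).
  { unfold x; apply Rmult_lt_reg_r with (2 * r * r'); [lra|].
    replace (_ / _ * _) with (r ^ 2 + r' ^ 2) by (field; lra).
    assert (0 < (r - r') ^ 2) by (apply pow2_gt_0; lra); simpl in *; lra. }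
  set (D := (rg ^ 2 - rl ^ 2) / (r * r')).
  (* Hence the power of [x^2 - 1] in the right-hand Q cancels the explicit power of [D], up to a
     power of 2. *)
  assert (HD : 0 < D /\ x ^ 2 - 1 = (D / 2) ^ 2).
  { unfold D, x, rg, rl; unfold Rmax, Rmin; destruct (Rle_dec r r').
    - split; [apply Rdiv_lt_0_compat; simpl; nra|field; lra].
    - split; [apply Rdiv_lt_0_compat; simpl; nra|field; lra]. }
  destruct HD as [HD HxD].
  pose proof (sin_gt_0 th' ltac:(lra) ltac:(lra)) as Hs'.
  destruct (kernel_series_integral d m a x th' Hx) as [V [HV [g [Hg HI]]]].
  pose proof (hyp_sparse_series d m a x V Hx Ha HV) as HQ.
  assert (Npoch : Cpoch a d <> 0).
  { clear - Ha; induction d as [|d IH]; simpl; [apply C1_nz|apply Cmult_neq_0; auto]. }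
  pose proof (sqrt_lt_R0 _ PI_RGT_0) as Hpi.
  assert (Npi : RtoC (sqrt PI) <> 0) by (apply RtoC_neq_0; lra).
  (* The factors of the integrand that do not depend on [th]: those of Q, then [(sin th')^a / x^a]
     from [hyp_kernel_series], then those of the Ferrers function. *)
  set (K0 := (Cexp (- ((nu + 1) / 2) * RtoC PI * Ci) * RtoC (sqrt PI) * CGamma a
    / Crpow 2 (RtoC (INR m) + 1 / 2) * Crpow (sin th') a / Crpow x a
    * fconst (m + d) m / RtoC (2 ^ m))%C).
  assert (E2m : RtoC (2 ^ m) <> 0) by (apply RtoC_neq_0, pow_nonzero; lra).
  assert (RHS : (Ci * RtoC (sqrt PI)
       / (Crpow 2 ((nu + 1) / 2) * Crpow (sin th') (nu / 2))
       * Crpow D ((nu + 2) / 2)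
       * LegendreQ (- ((nu + 2) / 2)) (RtoC (INR (m + d))) x
       * FerrersP (RtoC (INR m)) (RtoC (INR (m + d))) (cos th')
     = K0 * (V * RtoC (gpoly d m (cos th'))))%C).
  { rewrite ferrers_gpoly by exact Hth'.
    unfold LegendreQ.
    replace (RtoC (INR (m + d)) + - ((nu + 2) / 2) + 1)%C with (a + RtoC (INR d))%C
      by (unfold a; rewrite plus_INR, RtoC_plus; field).
    replace ((RtoC (INR (m + d)) + - ((nu + 2) / 2)) / 2 + 1)%C
      with ((a + RtoC (INR d) + 1) / 2)%C
      by (unfold a; rewrite plus_INR, RtoC_plus; field).
    rewrite <- (RtoC_plus (INR (m + d)) (3 / 2)), HQ, CGamma_poch by auto.
    rewrite HxD, Crpow_sqr, Crpow_opp, Crpow_div by lra.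
    rewrite (Crpow_plus x a), Crpow_nat by lra.
    rewrite !Rpow_mult_distr, !RtoC_mult.
    unfold K0; replace (Crpow (sin th') a) with (RtoC (sin th' ^ m) / Crpow (sin th') (nu / 2))%C.
    2:{ unfold a, Cminus; rewrite Crpow_plus, Crpow_opp, Crpow_nat by exact Hs'; reflexivity. }
    unfold Rdiv at 1; rewrite Rpow_mult_distr, pow_inv, RtoC_mult, (RtoC_inv (2 ^ m))
      by (apply pow_nonzero; lra).
    (* The orders of the two Q functions differ by 1/2, which is the origin of the factor [i] in the
       formula. *)
    replace (Cexp (- ((nu + 1) / 2) * RtoC PI * Ci)) with
      (Ci * Cexp (- ((nu + 2) / 2) * RtoC PI * Ci))%C.
    2:{ rewrite Ci_Cexp; f_equal; field. }
    replace (Crpow 2 ((nu + 2) / 2)) with (Crpow 2 ((nu + 1) / 2) * Crpow 2 (1 / 2))%C.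
    2:{ rewrite <- Crpow_plus; f_equal; field. }
    replace (Crpow 2 (RtoC (INR (m + d)) + 1)) with
      (Crpow 2 (RtoC (INR m) + 1 / 2) * Crpow 2 (1 / 2) * RtoC (2 ^ d))%C.
    2:{ rewrite <- Crpow_nat, <- !Crpow_plus by lra; f_equal.
        rewrite plus_INR, RtoC_plus; field. }
    pose proof (Crpow_neq_0 2 ((nu + 1) / 2)); pose proof (Crpow_neq_0 2 (1 / 2)).
    pose proof (Crpow_neq_0 2 (RtoC (INR m) + 1 / 2)); pose proof (Crpow_neq_0 (sin th') (nu / 2)).
    pose proof (Crpow_neq_0 D ((nu + 2) / 2)); pose proof (Crpow_neq_0 x a).
    assert (RtoC (2 ^ d) <> 0) by (apply RtoC_neq_0, pow_nonzero; lra).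
    assert (RtoC (x ^ d) <> 0) by (apply RtoC_neq_0, pow_nonzero; lra).
    field; repeat split; auto. }
  rewrite RHS.
  apply (is_RInt_ext (V := C_R_NormedModule)
    (fun th => K0 * (g th * RtoC ((sin th ^ 2) ^ m * gpoly d m (cos th) * sin th)))%C).
  2:{ apply is_RInt_C_scal, HI. }
  (* The integrands are compared only inside the interval, where [sin th > 0] and the power laws
     apply. *)
  intros th Hth.
  assert (Hth0 : 0 < th < PI).
  { pose proof PI_RGT_0; rewrite Rmin_left, Rmax_right in Hth by lra; exact Hth. }
  pose proof (sin_gt_0 th ltac:(lra) ltac:(lra)) as Hs.
  rewrite ferrers_gpoly by exact Hth0.
  destruct (hyp_kernel_series m a x th th' Hx Hth0 Hth') as [l [Hl Hh]].
  assert (El : l = g th) by (rewrite <- (Cseries_unique _ _ Hl); apply Cseries_unique, Hg).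
  subst l.
  replace ((x - cos th * cos th') / (sin th * sin th')) with (chi th) in Hh.
  2:{ unfold chi, x; field; lra. }
  unfold LegendreQ.
  replace (RtoC (INR m) - RtoC (1 / 2) + - ((nu + 1) / 2) + 1)%C with a
    by (unfold a, Rdiv; rewrite RtoC_mult, RtoC_inv by lra; field).
  replace ((RtoC (INR m) - RtoC (1 / 2) + - ((nu + 1) / 2)) / 2 + 1)%C with ((a + 1) / 2)%C
    by (unfold a, Rdiv; rewrite RtoC_mult, RtoC_inv by lra; field).
  replace (RtoC (INR m) - RtoC (1 / 2) + RtoC (3 / 2))%C with (RtoC (INR (m + 1))).
  2:{ rewrite <- RtoC_minus, <- RtoC_plus; f_equal; rewrite plus_INR; simpl INR; field. }
  replace (RtoC (INR m) - RtoC (1 / 2) + 1)%C with (RtoC (INR m) + 1 / 2)%C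
    by (unfold Rdiv; rewrite RtoC_mult, RtoC_inv by lra; field).
  (* The two powers of [chi^2 - 1] now have opposite exponents and cancel by [Crpow_opp], which
     holds for every base. *)
  replace (- ((nu + 1) / 2) / 2)%C with (- ((nu + 1) / 4))%C by field.
  rewrite Crpow_opp.
  pose proof (Crpow_neq_0 (chi th) a) as Nchi.
  set (h := hyp2F1reg ((a + 1) / 2) _ _ _) in *.
  replace h with (Crpow (sin th * sin th') a / Crpow x a * g th * Crpow (chi th) a)%C
    by (rewrite <- Hh; field; exact Nchi).
  rewrite Crpow_mult by auto.
  (* As [(nu + 2) / 2 = m + 1 - a], the complex power of [sin th] cancels against the one produced
     by the kernel expansion. The remaining [sin^(m+1)], with [sin^m] from the Ferrers function, is
     the weight times [sin th]. *)
  replace (Crpow (sin th) ((nu + 2) / 2)) with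
    (RtoC (sin th ^ m * sin th) / Crpow (sin th) a)%C.
  2:{ replace (sin th ^ m * sin th) with (sin th ^ (m + 1)) by (rewrite pow_add; ring).
      rewrite <- Crpow_nat by exact Hs.
      replace ((nu + 2) / 2)%C with (RtoC (INR (m + 1)) + - a)%C
        by (unfold a; rewrite plus_INR, RtoC_plus; simpl INR; field).
      rewrite Crpow_plus, Crpow_opp; reflexivity. }
  unfold K0.
  replace ((sin th ^ 2) ^ m) with (sin th ^ m * sin th ^ m)
    by (rewrite <- pow_mult, <- pow_add; f_equal; lia).
  unfold Rdiv; rewrite Rpow_mult_distr, pow_inv.
  rewrite !RtoC_mult, (RtoC_inv (2 ^ m)) by (apply pow_nonzero; lra).
  pose proof (Crpow_neq_0 (chi th ^ 2 - 1) ((nu + 1) / 4)).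
  pose proof (Crpow_neq_0 2 (RtoC (INR m) + 1 / 2)); pose proof (Crpow_neq_0 (sin th) a).
  pose proof (Crpow_neq_0 x a).
  eqC; field; repeat split; auto.
Qed.
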